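(* Let $\mathbf Y$ be a $d$-dimensional multivariate Pareto distribution, let $k\in[d]$, and let $\mathbf W^k$ be its $k$th extremal function. Suppose that $\mathbf W^k=(U_1-U_k,\dots,U_d-U_k)$ (in distribution) for some independent real random variables $U_1,\dots,U_d$ such that $U_i$ has a log-concave distribution for every $i\in[d]$. Then $\mathbf Y$ is $\mathrm{EMTP}_2$.
   Context: $[d]=\{1,\dots,d\}$; $\boldsymbol 1$ is the vector of ones; $\vee,\wedge$ are componentwise maximum and minimum. A random variable has a log-concave distribution if it has a log-concave Lebesgue density. Multivariate Pareto distribution: a random vector $\mathbf Y$ supported on $\mathcal L=\{\mathbf x\in\mathbb R^d:\max_i x_i>0\}$ such that $\mathbb P(\mathbf Y\le \mathbf z)=\lim_{u\to\infty}\mathbb P(\mathbf X-u\boldsymbol 1\le\mathbf z\mid \max_i X_i>u)$ for $\mathbf z\in\mathcal L$, for some random vector $\mathbf X$ with standard exponential margins. It satisfies $\mathbb P(\mathbf Y\in t\boldsymbol 1+A)=e^{-t}\mathbb P(\mathbf Y\in A)$ for $t>0$, Borel $A\subset\mathcal L$. $\mathbf Y$ is assumed to have a Lebesgue density. For $k\in[d]$, $\mathbf Y^k$ is $\mathbf Y$ conditioned on $\{Y_k>0\}$; one has $\mathbf Y^k\overset{d}{=}\mathbf W^k+E\boldsymbol 1$ with $E$ standard exponential independent of the $d$-variate vector $\mathbf W^k$, $W^k_k=0$ a.s.; $\mathbf W^k$ is called the $k$th extremal function. A random vector with density $f$ is $\mathrm{MTP}_2$ if $f(\mathbf x\vee\mathbf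 y)f(\mathbf x\wedge\mathbf y)\ge f(\mathbf x)f(\mathbf y)$ for all $\mathbf x,\mathbf y$; $\mathbf Y$ is $\mathrm{EMTP}_2$ if $\mathbf Y^k$ is $\mathrm{MTP}_2$ for all $k\in[d]$. *)

(* Defs.v *)
From HB Require Import structures.
From mathcomp Require Import all_boot all_order all_algebra.
From mathcomp Require Import all_classical all_reals all_analysis.
Set Implicit Arguments.
Unset Strict Implicit.
Unset Printing Implicit Defensive.
Import Order.TTheory GRing.Theory Num.Theory.
Import numFieldNormedType.Exports.

Local Open Scope classical_set_scope.
Local Open Scope ring_scope.

(* R^d is [d.-tuple R]; its sigma-algebra is generated by the coordinate maps,
   so it is the Borel one. *)

Lemma sigma_finite_pushforward d1 d2 (T1 : measurableType d1)
    (T2 : measurableType d2) (R : realType)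
    (m : {measure set T1 -> \bar R}) (f : T1 -> T2) (g : T2 -> T1) :
  sigma_finite setT m -> measurable_fun setT f -> measurable_fun setT g ->
  cancel f g ->
  exists nu : {sigma_finite_measure set T2 -> \bar R},
    pushforward m f = nu :> (set T2 -> \bar R).
Proof.
move=> sm mf mg fK.
pose mu : {measure set T2 -> \bar R} :=
  measure_function_pushforward__canonical__measure_function_Measure m mf.
have sf : sigma_finite setT mu.
  have [F FT Foo] := sm.
  exists (fun i => g @^-1` F i).
    by rewrite -preimage_bigcup -FT preimage_setT.
  move=> i; have [mF Fi] := Foo i; split.
    by rewrite -[X in measurable X]setTI; exact: mg.
  by rewrite /= /pushforward -comp_preimage (_ : g \o f = id)//; apply/funext.
pose S := Measure_isSigmaFinite.Build _ _ _ mu sf.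
pose sfmu : {sigma_finite_measure set T2 -> \bar R} :=
  HB.pack (mu : set T2 -> \bar R) mu S.
by exists sfmu.
Qed.
Lemma sigma_finite_pushforward_prod d1 d2 d3 (T1 : measurableType d1)
    (T2 : measurableType d2) (T3 : measurableType d3) (R : realType)
    (m1 : {sigma_finite_measure set T1 -> \bar R})
    (m2 : {sigma_finite_measure set T2 -> \bar R})
    (f : T1 * T2 -> T3) (g : T3 -> T1 * T2) :
  measurable_fun setT f -> measurable_fun setT g -> cancel f g ->
  exists nu : {sigma_finite_measure set T3 -> \bar R},
    pushforward (m1 \x m2)%E f = nu :> (set T3 -> \bar R).
Proof.
move=> mf mg fK.
apply: (@sigma_finite_pushforward _ _ _ _ _
  [the {measure set _ -> \bar R} of (m1 \x m2)%E] f g) => //=.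
(* The canonical [SigmaFiniteMeasure] instance on [_ \x _] only fires for
   subprobabilities, hence this direct argument. *)
have /sigma_finiteP[F [TF ndF Foo]] := sigma_finiteT m1.
have /sigma_finiteP[G [TG ndG Goo]] := sigma_finiteT m2.
exists (fun n => F n `*` G n).
  rewrite -setXTT TF TG predeqE => -[x y]; split.
    move=> [/= [n _ Fnx] [k _ Gky]]; exists (maxn n k) => //; split.
    - by move: x Fnx; exact/subsetPset/ndF/leq_maxl.
    - by move: y Gky; exact/subsetPset/ndG/leq_maxr.
  by move=> [n _ []/= ? ?]; split; exists n.
move=> k; have [? ?] := Foo k; have [? ?] := Goo k.
split; first exact: measurableX.
by rewrite product_measure1E// lte_mul_pinfty// ge0_fin_numE.
Qed.

Section tuple_lebesgue.
Context {R : realType}.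
Local Notation mR := (measurableTypeR R).

Definition tcons n (p : mR * n.-tuple R) : n.+1.-tuple R :=
  [tuple of p.1 :: p.2].

Definition tuncons n (t : n.+1.-tuple R) : mR * n.-tuple R :=
  (thead t, [tuple of behead t]).

Fixpoint lebesgue_tuple n : set (n.-tuple R) -> \bar R :=
  match n with
  | 0 => dirac [tuple]
  | m.+1 => pushforward (lebesgue_measure \x @lebesgue_tuple m)%E (@tcons m)
  end.

Lemma measurable_tcons n : measurable_fun setT (@tcons n).
Proof. exact: measurable_cons. Qed.

Lemma measurable_tuncons n : measurable_fun setT (@tuncons n).
Proof.
apply/measurable_fun_pair; [exact: measurable_tnth|exact: measurable_behead].
Qed.

Lemma tconsK n : cancel (@tcons n) (@tuncons n).
Proof. by move=> [x t]; congr (_, _); apply: val_inj. Qed.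

Lemma lebesgue_tuple_ex n :
  exists nu :
      {sigma_finite_measure set (n.-tuple R : measurableType _) -> \bar R},
    @lebesgue_tuple n = nu :> (set (n.-tuple R) -> \bar R).
Proof.
elim: n => [|n [nu nuE]] /=.
  by exists (dirac [tuple] : {sigma_finite_measure set (0.-tuple R) -> \bar R}).
rewrite nuE.
exact: (sigma_finite_pushforward_prod lebesgue_measure nu (@measurable_tcons n)
  (@measurable_tuncons n) (@tconsK n)).
Qed.
End tuple_lebesgue.

Section tuple_lebesgue_measure.
Context {R : realType}.
Local Open Scope ereal_scope.
Variable n : nat.
Local Notation T := (n.-tuple R : measurableType _).
Local Notation leb := (@lebesgue_tuple R n : set T -> \bar R).

Let leb0 : leb set0 = 0.
Proof. by have [nu ->] := @lebesgue_tuple_ex R n; rewrite measure0. Qed.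

Let leb_ge0 A : 0 <= leb A.
Proof. by have [nu ->] := @lebesgue_tuple_ex R n; exact: measure_ge0. Qed.

Let leb_sigma_additive : semi_sigma_additive leb.
Proof.
by have [nu ->] := @lebesgue_tuple_ex R n; exact: measure_semi_sigma_additive.
Qed.

HB.instance Definition _ :=
  isMeasure.Build _ T R leb leb0 leb_ge0 leb_sigma_additive.

Let leb_sigma_finite : sigma_finite setT leb.
Proof. by have [nu ->] := @lebesgue_tuple_ex R n; exact: sigma_finiteT. Qed.

HB.instance Definition _ :=
  Measure_isSigmaFinite.Build _ T R leb leb_sigma_finite.

End tuple_lebesgue_measure.

Lemma lebesgue_tuple_box (R : realType) n (A : 'I_n -> set R) :
  (forall i, measurable (A i)) ->
  lebesgue_tuple [set x : n.-tuple R | forall i, A i (tnth x i)] =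
  (\prod_(i < n) lebesgue_measure (A i))%E.
Proof.
elim: n A => [|n IH] A mA.
  rewrite big_ord0 /= diracE mem_set//.
  by move=> [].
have [nu nuE] := @lebesgue_tuple_ex R n.
rewrite big_ord_recl -IH//= nuE -product_measure1E//; first last.
- rewrite (_ : [set x | _] = \bigcap_(i in [set: 'I_n])
      ((fun x : n.-tuple R => tnth x i) @^-1` A (lift ord0 i))).
    apply: fin_bigcap_measurable => // i _; rewrite -[X in measurable X]setTI.
    exact: measurable_tnth.
  by apply/seteqP; split => x /= xA i => [_|]; exact: xA.
- exact: mA.
congr ((_ \x _)%E _); apply/seteqP; split => -[x t] /=.
  move=> h; split; first exact: (h ord0).
  by move=> i; have := h (lift ord0 i); rewrite tnthS.
by move=> [x0 h] i; case: (unliftP ord0 i) => [j ->|->//]; rewrite tnthS.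
Qed.

(* A law is a set function that matters on measurable sets only. *)
Definition same_law d (T : measurableType d) (R : realType)
    (mu nu : set T -> \bar R) : Prop :=
  forall A, measurable A -> mu A = nu A.

Definition is_density d (T : measurableType d) (R : realType)
    (lambda mu : set T -> \bar R) (f : T -> R) : Prop :=
  [/\ measurable_fun setT f, forall x, 0 <= f x &
      same_law mu (fun A => \int[lambda]_(x in A) (f x)%:E)%E].

Definition cond_prob d (T : measurableType d) (R : realType)
    (P : probability T R) (A B : set T) : R :=
  fine (P (A `&` B)) / fine (P B).

Section one_dimensional.
Context d (Omega : measurableType d) (R : realType) (P : probability Omega R).

Definition std_exponential (E : Omega -> R) : Prop :=
  same_law (pushforward P E) (exponential_prob 1).

Definition log_concave (f : R -> R) : Prop :=
  forall x y t, 0 < t < 1 ->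
    f x `^ t * f y `^ (1 - t) <= f (t * x + (1 - t) * y).

Definition log_concave_law (U : Omega -> R) : Prop :=
  exists2 f, is_density lebesgue_measure (pushforward P U) f & log_concave f.

(* Subfamilies are covered: take [A i = setT] outside of them. *)
Definition independent_family n (U : 'I_n -> Omega -> R) : Prop :=
  forall A : 'I_n -> set R, (forall i, measurable (A i)) ->
    fine (P [set w | forall i, A i (U i w)]) =
    \prod_(i < n) fine (P (U i @^-1` A i)).

Definition independent d1 d2 (T1 : measurableType d1) (T2 : measurableType d2)
    (V : Omega -> T1) (W : Omega -> T2) : Prop :=
  forall A B, measurable A -> measurable B ->
    P (V @^-1` A `&` W @^-1` B) = (P (V @^-1` A) * P (W @^-1` B))%E.

End one_dimensional.

Section multivariate_pareto.
Context {R : realType} {d : nat}.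
Implicit Types x y : d.-tuple R.

Definition tshift x (u : R) : d.-tuple R := [tuple tnth x i + u | i < d].
Definition tmax x y : d.-tuple R :=
  [tuple Num.max (tnth x i) (tnth y i) | i < d].
Definition tmin x y : d.-tuple R :=
  [tuple Num.min (tnth x i) (tnth y i) | i < d].
Definition tle x y : Prop := forall i, tnth x i <= tnth y i.
(* [max_gt u x] is [u < max_i x_i]. *)
Definition max_gt (u : R) x : Prop := exists i, u < tnth x i.

Definition calL : set (d.-tuple R) := max_gt 0.

Definition multivariate_pareto dO (Omega : measurableType dO)
    (P : probability Omega R) (Y : {RV P >-> d.-tuple R}) : Prop :=
  P (Y @^-1` calL) = 1%E /\
  exists (d' : measure_display) (Omega' : measurableType d')
      (P' : probability Omega' R) (X : {RV P' >-> d.-tuple R}),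
    (forall i, std_exponential P' (fun w => tnth (X w) i)) /\
    forall z, calL z ->
      cond_prob P' [set w | tle (tshift (X w) (- u)) z] [set w | max_gt u (X w)]
        @[u --> +oo] --> fine (P [set w | tle (Y w) z]).

Section conditioned.
Context dO (Omega : measurableType dO) (P : probability Omega R).
Variable Y : {RV P >-> d.-tuple R}.

(* The law of Y conditioned on Y_k > 0. *)
Definition cond_pos_law (k : 'I_d) (A : set (d.-tuple R)) : \bar R :=
  (cond_prob P (Y @^-1` A) [set w | 0 < tnth (Y w) k])%:E.

(* Being the extremal function is a property of the law of W only; E need not
   live on the probability space of W, so W is replaced there by a copy. *)
Definition extremal_function (k : 'I_d) dW (OmegaW : measurableType dW)
    (PW : probability OmegaW R) (W : {RV PW >-> d.-tuple R}) : Prop :=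
  PW [set w | tnth (W w) k = 0] = 1%E /\
  exists (d' : measure_display) (Omega' : measurableType d')
      (P' : probability Omega' R) (W' : {RV P' >-> d.-tuple R})
      (E : {RV P' >-> R}),
    [/\ same_law (distribution P' W') (distribution PW W),
        std_exponential P' E,
        independent P' W' E &
        same_law (cond_pos_law k)
          (pushforward P' (fun w => tshift (W' w) (E w)))].

End conditioned.

(* Densities are only determined up to null sets: some version is required to
   satisfy the inequality at all points. *)
Definition MTP2 (mu : set (d.-tuple R) -> \bar R) : Prop :=
  exists2 f, is_density (@lebesgue_tuple R d) mu f &
    forall x y, f x * f y <= f (tmax x y) * f (tmin x y).

Definition EMTP2 dO (Omega : measurableType dO)
    (P : probability Omega R) (Y : {RV P >-> d.-tuple R}) : Prop :=
  forall k, MTP2 (cond_pos_law Y k).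

End multivariate_pareto.

(* Main.v *)
Require Import Defs.
From HB Require Import structures.
From mathcomp Require Import all_boot all_order all_algebra.
From mathcomp Require Import all_classical all_reals all_analysis.
From mathcomp Require Import measurable_realfun.
From mathcomp Require Import ring lra.
Set Implicit Arguments.
Unset Strict Implicit.
Unset Printing Implicit Defensive.
Import Order.TTheory GRing.Theory Num.Theory.
Import numFieldNormedType.Exports.
Local Open Scope classical_set_scope.
Local Open Scope ring_scope.

(* Write f_i for the log-concave density of U_i, and put
   h(y) = int prod_i f_i(y_i + s) ds, which is invariant under y |-> y + t 1.
   A change of variables shows that W^k + E 1 has density
   1{y_k > 0} e^(-y_k) h(y).  The tail P(max_i X_i > u) of a vector with standard
   exponential margins lies between e^(-u) and d e^(-u), so if
   P(max X > u + t) / P(max X > u) converges, the limit is e^(-t) (Cesaro means of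
   logarithms); this yields P(Y in t 1 + A) = e^(-t) P(Y in A), which transports the
   density from {y_k > 0} to all of L.  Hence each Y^m has density proportional to
   1{y_m > 0} e^(-y_k) h(y).  Log-concavity gives
   f(a) f(d) <= f(b) f(c) for a <= b, c <= d with a + d = b + c, and h inherits
   the MTP2 inequality by symmetrizing the double integral h(x) h(y) in its two
   integration variables, as in the four functions theorem.  Log-concave densities
   are bounded, so h is finite everywhere and the inequality holds pointwise. *)

(** * Lebesgue measure on tuples *)

Section product_integral.
Local Open Scope ereal_scope.
Context d1 d2 (T1 : measurableType d1) (T2 : measurableType d2) (R : realType).
Variables (m1 : {sigma_finite_measure set T1 -> \bar R}).
Variables (m2 : {sigma_finite_measure set T2 -> \bar R}).

Lemma ge0_integral_prodM (f : T1 -> \bar R) (g : T2 -> \bar R) :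
  measurable_fun setT f -> measurable_fun setT g ->
  (forall x, 0 <= f x) -> (forall y, 0 <= g y) ->
  \int[m1 \x m2]_z (f z.1 * g z.2) = \int[m1]_x f x * \int[m2]_y g y.
Proof.
move=> mf mg f0 g0.
rewrite fubini_tonelli1//; last 2 first.
- apply: emeasurable_funM; first exact: (measurableT_comp mf measurable_fst).
  exact: (measurableT_comp mg measurable_snd).
- by move=> z; exact: mule_ge0.
rewrite /fubini_F/=.
under eq_integral => x _ do rewrite ge0_integralZl//.
by rewrite ge0_integralZr// integral_ge0.
Qed.

End product_integral.

Section density_measure.
Local Open Scope ereal_scope.
Context d (T : measurableType d) (R : realType).

(** Uniqueness of measures and continuity from below apply to bundled measures; this bundles a set
    function given by a density so that both become available for it. *)
Lemma ge0_density_measure (mu : {measure set T -> \bar R}) (f : T -> \bar R) :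
  measurable_fun setT f -> (forall x, 0 <= f x) ->
  exists nu : {measure set T -> \bar R},
    nu = (fun A => \int[mu]_(x in A) f x) :> (set T -> \bar R).
Proof.
move=> mf f0.
pose nu (A : set T) := \int[mu]_(x in A) f x.
have nu0 : nu set0 = 0 by rewrite /nu integral_set0.
have nu_ge0 A : 0 <= nu A by apply: integral_ge0.
have nus : semi_sigma_additive nu.
  move=> /= F mF tF mUF; rewrite /nu; apply: cvg_toP.
    by apply: is_cvg_nneseries => n _ _; exact: nu_ge0.
  by rewrite ge0_integral_bigcup//; exact: measurable_funTS.
pose nuM := isMeasure.Build _ T R nu nu0 nu_ge0 nus.
pose nu' : {measure set T -> \bar R} := HB.pack nu nuM.
by exists nu'.
Qed.

End density_measure.

(** * Invariance of Lebesgue measure under translations and reflections *)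

Section lebesgue_translation.
Local Open Scope ereal_scope.
Context {R : realType}.
Local Notation mu := (@lebesgue_measure R).

(** Half-open intervals determine Lebesgue measure, and a translation preserves their lengths. *)
Lemma lebesgue_measure_shift (u : R) (A : set R) : measurable A ->
  pushforward mu (fun x : measurableTypeR R => (x + u)%R : measurableTypeR R) A = mu A.
Proof.
have ms : measurable_fun [set: measurableTypeR R]
    (fun x : measurableTypeR R => (x + u)%R : measurableTypeR R).
  exact: measurable_funD.
move=> mA; apply/esym.
pose m := measure_function_pushforward__canonical__measure_function_Measure mu ms.
apply: (@lebesgue_measure_unique R m) => //= _ [[a b]] _ <-.
rewrite /pushforward.
rewrite [X in _ = mu X](_ : _ = `](a - u)%R, (b - u)%R]%classic); last first.
  by apply/seteqP; split => x /=; rewrite !in_itv/= ltrBlDr lerBrDr.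
rewrite !lebesgue_measure_itv/= !lte_fin ltrD2r.
by case: ifPn => // _; rewrite -!EFinD; congr (_%:E); ring.
Qed.

Lemma ge0_integral_shift (u : R) (f : R -> \bar R) :
  measurable_fun setT f -> (forall x, 0 <= f x) ->
  \int[mu]_x f (x + u)%R = \int[mu]_x f x.
Proof.
move=> mf f0.
transitivity (\int[pushforward mu
    (fun x : measurableTypeR R => (x + u)%R : measurableTypeR R)]_x f x).
  rewrite ge0_integral_pushforward//.
  by apply: measurable_funD.
by apply: eq_measure_integral => [|ms A mA _];
  [exact: measurable_funD|exact: lebesgue_measure_shift].
Qed.

Lemma ge0_integral_reflect (u : R) (f : R -> \bar R) :
  measurable_fun setT f -> (forall x, 0 <= f x) ->
  \int[mu]_x f (u - x)%R = \int[mu]_x f x.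
Proof.
move=> mf f0.
rewrite -[RHS](ge0_integral_shift u)//.
have mfu : measurable_fun [set: R] (fun x : R => f (x + u)%R).
  by apply: measurableT_comp => //; exact: measurable_funD.
transitivity (\int[pushforward mu (-%R : _ -> measurableTypeR R)]_x f (x + u)%R).
  rewrite ge0_integral_pushforward//.
  by apply: eq_integral => x _ /=; rewrite addrC.
by apply: eq_measure_integral => A mA _; exact: lebesgue_measureN.
Qed.

End lebesgue_translation.

Section tuple_lebesgue_integral.
Local Open Scope ereal_scope.
Context {R : realType}.
Local Notation leb n := (@lebesgue_tuple R n).

Lemma measurable_tshift d (T : measurableType d) n (f : T -> n.-tuple R) (g : T -> R) :
  measurable_fun setT f -> measurable_fun setT g ->
  measurable_fun setT (fun x => tshift (f x) (g x)).
Proof.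
move=> mf mg; apply/measurable_fun_tnthP => i.
rewrite (_ : _ \o _ = fun x => (tnth (f x) i + g x)%R); last first.
  by apply/funext => x /=; rewrite tnth_mktuple.
by apply: measurable_funD => //; exact: measurableT_comp (measurable_tnth i) mf.
Qed.

Lemma ge0_integral_lebesgue_tupleS n (f : n.+1.-tuple R -> \bar R) :
  measurable_fun setT f -> (forall x, 0 <= f x) ->
  \int[leb n.+1]_x f x =
  \int[lebesgue_measure]_x \int[leb n]_t f (tcons (x, t)).
Proof.
move=> mf f0; rewrite /= (ge0_integral_pushforward (@measurable_tcons R n))//.
rewrite preimage_setT fubini_tonelli1//; last by move=> x /=.
by apply: measurableT_comp => //; exact: measurable_tcons.
Qed.

(** Induction on [n]: Tonelli separates the first coordinate, translation invariance on the line
    handles it, and the induction hypothesis handles the remaining coordinates. *)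
Lemma ge0_integral_tshift n (u : R) (f : n.-tuple R -> \bar R) :
  measurable_fun setT f -> (forall x, 0 <= f x) ->
  \int[leb n]_x f (tshift x u) = \int[leb n]_x f x.
Proof.
elim: n f => [|n IH] f mf f0.
  apply: eq_integral => x _; congr f; apply: eq_from_tnth; by case.
have mfs : measurable_fun setT (fun x => f (tshift x u)).
  by apply: measurableT_comp => //; exact: measurable_tshift.
rewrite !ge0_integral_lebesgue_tupleS//.
have E x (t : n.-tuple R) : tshift (tcons (x, t)) u = tcons ((x + u)%R, tshift t u).
  apply: eq_from_tnth => i; rewrite tnth_mktuple.
  by case: (unliftP ord0 i) => [j ->|->]; rewrite ?tnthS ?tnth0 ?tnth_mktuple.
pose g (x : R) : \bar R := \int[leb n]_t f (tcons (x, t)).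
have mft (x : R) : measurable_fun setT (fun t : n.-tuple R => f (tcons (x, t))).
  apply: measurableT_comp => //; apply: (measurableT_comp (@measurable_tcons R n)).
  exact: pair1_measurable.
rewrite -(ge0_integral_shift u (f := g)); first last.
- by move=> x; apply: integral_ge0.
- apply: (measurable_fun_fubini_tonelli_F (f \o @tcons R n)) => [|x]; last exact: f0.
  by apply: measurableT_comp => //; exact: measurable_tcons.
apply: eq_integral => x _; rewrite /g -(IH _ (mft _) (fun=> f0 _)).
by apply: eq_integral => t _; rewrite E.
Qed.

Lemma measurable_tuple_prod n (f : 'I_n -> R -> R) :
  (forall i, measurable_fun setT (f i)) ->
  measurable_fun setT (fun x : n.-tuple R => \prod_(i < n) f i (tnth x i))%R.
Proof.
move=> mf; apply: measurable_prod => i _.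
exact: measurableT_comp (mf i) (measurable_tnth i).
Qed.

Lemma ge0_integral_tuple_prod n (f : 'I_n -> R -> R) :
  (forall i, measurable_fun setT (f i)) -> (forall i x, 0 <= f i x)%R ->
  \int[leb n]_x (\prod_(i < n) f i (tnth x i))%:E =
  \prod_(i < n) \int[lebesgue_measure]_x (f i x)%:E.
Proof.
elim: n f => [|n IH] f mf f0.
  under eq_integral do rewrite big_ord0.
  by rewrite big_ord0 integral_cst//= mul1e diracT.
rewrite ge0_integral_lebesgue_tupleS//; last 2 first.
- by apply/measurable_EFinP; exact: measurable_tuple_prod.
- by move=> x; rewrite lee_fin prodr_ge0.
pose g i := f (lift ord0 i).
pose I := \prod_(i < n) \int[lebesgue_measure]_x (g i x)%:E.
transitivity (\int[lebesgue_measure]_x ((f ord0 x)%:E * I)).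
  apply: eq_integral => x _.
  rewrite /I -(IH g (fun i => mf _) (fun i => f0 _)).
  rewrite -ge0_integralZl//; last 3 first.
  - apply/measurable_EFinP; apply: (@measurable_tuple_prod _ g) => i; exact: mf.
  - by move=> t _; rewrite lee_fin prodr_ge0// => i _; exact: f0.
  - by rewrite lee_fin.
  apply: eq_integral => t _; rewrite big_ord_recl tnth0 EFinM.
  by congr (_ * _%:E); apply: eq_bigr => i _; rewrite tnthS.
rewrite ge0_integralZr//.
- by rewrite big_ord_recl.
- by apply/measurable_EFinP; exact: mf.
- by move=> x _; rewrite lee_fin.
- by rewrite prode_ge0// => i _; apply: integral_ge0 => x _; rewrite lee_fin /g.
Qed.

Lemma measurable_tle n (z : n.-tuple R) : measurable [set x : n.-tuple R | tle x z].
Proof.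
rewrite (_ : mkset _ = \bigcap_(i in [set: 'I_n])
    ((fun x : n.-tuple R => tnth x i) @^-1` `]-oo, tnth z i])).
  apply: fin_bigcap_measurable => // i _; rewrite -[X in measurable X]setTI.
  exact: measurable_tnth.
apply/seteqP; split => x /= xz i; first by move=> _; rewrite /= in_itv/=.
by have := xz i Logic.I; rewrite /= in_itv.
Qed.

(** This makes lower orthants, hence distribution functions, sufficient for identifying measures on
    tuples. The nontrivial inclusion amounts to measurability of the coordinates with respect to the
    generated sigma-algebra. *)
Lemma tle_generate n : @measurable _ (n.-tuple R) =
  <<s [set [set x : n.-tuple R | tle x z] | z in [set: n.-tuple R]] >>.
Proof.
apply/seteqP; split; last first.
  apply: smallest_sub; first exact: sigma_algebra_measurable.
  by move=> _ [z _ <-]; exact: measurable_tle.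
set G := (X in <<s X >>).
pose T := g_sigma_algebraType G.
move=> A mA.
suff /(_ measurableT _ mA) : measurable_fun setT (fun x : T => x : n.-tuple R).
  by rewrite setTI.
apply/measurable_fun_tnthP => i.
apply: (measurability _ (RGenOInfty.measurableE R)).
move=> _ [_ [r ->] <-]; rewrite setTI.
(* Only coordinate [i] keeps the bound [r]. The other bounds grow with [k], so the orthants below
   the [z k] exhaust the half-space where coordinate [i] is at most [r]. *)
pose z k := [tuple if j == i then r else k%:R | j < n].
rewrite (_ : _ @^-1` _ = ~` \bigcup_k [set x | tle x (z k)]).
  apply: (@measurableC _ T); apply: (@bigcup_measurable _ T) => k _.
  by apply: sub_sigma_algebra; exists (z k).
apply/seteqP; split => x /=; rewrite in_itv/= andbT.
  by move=> rx [k _ /(_ i)]; rewrite tnth_mktuple eqxx leNgt rx.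
move=> h; rewrite ltNge; apply/negP => xr; apply: h.
exists (Num.truncn (\sum_(i < n) `|tnth x i|)%R).+1 => // j.
rewrite tnth_mktuple; case: eqP => [->//|_].
rewrite ltW// (le_lt_trans _ (truncnS_gt _))//.
by rewrite (bigD1 j)//= (le_trans (ler_norm _))// lerDl sumr_ge0.
Qed.

(** Lower orthants are stable under intersection, the corners combining by [tmin], and those with
    corner [(k,...,k)] exhaust the space. The uniqueness theorem for measures on a generating
    pi-system therefore applies. *)
Lemma tuple_measure_unique n (m1 m2 : {measure set (n.-tuple R) -> \bar R}) :
  (forall z, m1 [set x | tle x z] = m2 [set x | tle x z]) ->
  (forall z, m1 [set x | tle x z] < +oo) ->
  same_law m1 m2.
Proof.
move=> m12 m1oo A mA.
pose g k := [set x : n.-tuple R | tle x [tuple k%:R | i < n]].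
apply: (measure_unique [set [set x : n.-tuple R | tle x z] | z in [set: n.-tuple R]] g) => //.
- exact: tle_generate.
- move=> _ _ [z1 _ <-] [z2 _ <-]; exists (tmin z1 z2) => //.
  apply/seteqP; split => x /=.
    by move=> h; split=> i; have := h i; rewrite tnth_mktuple le_min => /andP[].
  by move=> [h1 h2] i; rewrite tnth_mktuple le_min h1 h2.
- apply/seteqP; split => // x _.
  exists (Num.truncn (\sum_(i < n) `|tnth x i|)%R).+1 => // i.
  rewrite tnth_mktuple ltW// (le_lt_trans _ (truncnS_gt _))//.
  by rewrite (bigD1 i)//= (le_trans (ler_norm _))// lerDl sumr_ge0.
- by move=> _ [z _ <-].
- by move=> k; exact: m1oo.
Qed.

End tuple_lebesgue_integral.

(** * Log-concavity and the MTP2 inequality *)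

Section log_concave_functions.
Context {R : realType}.
Variable f : R -> R.
Hypothesis f0 : forall x, 0 <= f x.
Hypothesis lcf : log_concave f.

(** Both [b] and [c] are convex combinations of [a] and [e], with weights [t, 1 - t] and [1 - t, t].
    Multiplying the two log-concavity inequalities makes the exponents of [f a] and of [f e] add up
    to 1. *)
Lemma log_concave_mul a b c e : a <= b -> a <= c -> a + e = b + c ->
  f a * f e <= f b * f c.
Proof.
move=> ab ac aebc.
have [ab'|aNb] := eqVneq a b; first by rewrite -ab' (_ : e = c)//; lra.
have [ac'|aNc] := eqVneq a c; first by rewrite -ac' mulrC (_ : e = b)//; lra.
have {}ab : a < b by rewrite lt_neqAle aNb.
have {}ac : a < c by rewrite lt_neqAle aNc.
pose t := (e - b) / (e - a).
have ea : 0 < e - a by lra.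
have t01 : 0 < t < 1.
  by rewrite /t divr_gt0 ?ltr_pdivrMr//=; lra.
have bE : b = t * a + (1 - t) * e by rewrite /t; field; rewrite gt_eqF.
have cE : c = (1 - t) * a + (1 - (1 - t)) * e by lra.
have t01' : 0 < 1 - t < 1 by lra.
rewrite bE cE.
have := ler_pM (mulr_ge0 (powR_ge0 _ _) (powR_ge0 _ _))
  (mulr_ge0 (powR_ge0 _ _) (powR_ge0 _ _)) (lcf a e t01) (lcf a e t01').
apply: le_trans; rewrite mulrACA -!powRD; first last.
- by apply/implyP; rewrite addrCA subrr addr0 oner_eq0.
- by apply/implyP; rewrite subrKC oner_eq0.
by rewrite subrKC addrCA subrr addr0 !powRr1.
Qed.

(** Quasi-concavity: both factors of the weighted geometric mean of [f x] and [f y] are bounded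
    below by powers of the minimum, with exponents adding up to 1. *)
Lemma log_concave_min x y z : x <= z <= y -> Num.min (f x) (f y) <= f z.
Proof.
move=> /andP[xz zy].
have [->|xNz] := eqVneq x z; first by rewrite ge_min lexx.
have [->|zNy] := eqVneq z y; first by rewrite ge_min lexx orbT.
have {}xz : x < z by rewrite lt_neqAle xNz.
have {}zy : z < y by rewrite lt_neqAle zNy.
pose t := (y - z) / (y - x).
have yx : 0 < y - x by lra.
have t01 : 0 < t < 1.
  by rewrite /t divr_gt0 ?ltr_pdivrMr//=; lra.
have zE : z = t * x + (1 - t) * y by rewrite /t; field; rewrite gt_eqF.
rewrite zE (le_trans _ (lcf x y t01))//.
set m := Num.min _ _.
have m0 : 0 <= m by rewrite le_min !f0.
rewrite -[leLHS]powRr1// -[X in m `^ X](subrKC t) powRD; last first.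
  by apply/implyP; rewrite subrKC oner_eq0.
rewrite ler_pM ?powR_ge0//; apply: ge0_ler_powR; rewrite ?nnegrE ?f0//.
all: by [lra|rewrite ge_min lexx ?orbT].
Qed.

Hypothesis mf : measurable_fun setT f.
Hypothesis intf : (\int[lebesgue_measure]_x (f x)%:E = 1)%E.

(** An interval on which [f] is at least [m] carries mass at least [m] times its length, and the
    total mass is 1. *)
Let log_concave_length u v m : u <= v -> 0 <= m ->
  (forall z, u <= z <= v -> m <= f z) -> m * (v - u) <= 1.
Proof.
move=> uv m0 mfz; rewrite -lee_fin -intf.
apply: (@le_trans _ _ (\int[lebesgue_measure]_(x in `[u, v]) (f x)%:E)%E); last first.
  apply: ge0_subset_integral => //; first exact/measurable_EFinP.
  by move=> x _; rewrite lee_fin.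
apply: (@le_trans _ _ (\int[lebesgue_measure]_(x in `[u, v]) (cst m%:E x))%E).
  rewrite integral_cst//= lebesgue_measure_itv/= lte_fin.
  by case: ltgtP uv => // -> _; rewrite ?subrr ?mulr0 ?mule0.
apply: ge0_le_integral => //.
by apply/measurable_EFinP; exact: measurable_funTS.
Qed.

(** Suppose [f x > f p] and let [c] be the midpoint of [p] and [x]. Log-concavity gives
    [f p * f x <= f c ^+ 2], so [m = min (f c) (f x)] satisfies [f p * f x <= m ^+ 2]. Since [f] is
    at least [m] between [c] and [x], the mass bound yields [m * |x - p| / 2 <= 1], and squaring
    concludes. *)
Let log_concave_bound_away p x : p != x -> 0 < f p ->
  f x <= Num.max (f p) (4 / (f p * (x - p) ^+ 2)).
Proof.
move=> px fp; rewrite le_max; have [//|/= pltx] := leP (f x) (f p).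
pose c := (p + x) / 2.
have fc : f p * f x <= f c * f c.
  have [xp|xp] := leP p x.
    by apply: log_concave_mul; rewrite /c; lra.
  by rewrite mulrC; apply: log_concave_mul; rewrite /c; lra.
pose m := Num.min (f c) (f x).
have m0 : 0 <= m by rewrite le_min !f0.
have mm : f p * f x <= m ^+ 2.
  rewrite /m minEle; case: ifPn => _; first by rewrite expr2.
  by rewrite expr2 ler_pM// ltW.
have ml : m * (`|x - p| / 2) <= 1.
  have [xp|xp] := leP p x.
    rewrite ger0_norm ?subr_ge0// (_ : _ / 2 = x - c); last by rewrite /c; lra.
    apply: log_concave_length => //; first by rewrite /c; lra.
    by move=> z czx; exact: log_concave_min.
  rewrite ltr0_norm ?subr_lt0// (_ : _ / 2 = c - x); last by rewrite /c; lra.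
  apply: log_concave_length => //; first by rewrite /c; lra.
  by move=> z czx; rewrite /m minC; exact: log_concave_min.
have xp2 : 0 < (x - p) ^+ 2 by rewrite exprn_even_gt0//= subr_eq0 eq_sym.
rewrite ler_pdivlMr; last exact: mulr_gt0.
have : (m * (`|x - p| / 2)) ^+ 2 <= 1 by rewrite expr_le1// !mulr_ge0.
rewrite !exprMn real_normK ?num_real// => h.
have : f p * f x * ((x - p) ^+ 2) <= m ^+ 2 * (x - p) ^+ 2 by rewrite ler_wpM2r// ltW.
lra.
Qed.

(** A function vanishing outside a single point has integral 0, so [f] must be positive at some
    point different from any given one. *)
Let log_concave_two_points : exists p q, [/\ p < q, 0 < f p & 0 < f q].
Proof.
have int1 a : exists2 p, p != a & 0 < f p.
  apply/not_exists2P => h.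
  suff : (\int[lebesgue_measure]_x (f x)%:E = 0)%E.
    by rewrite intf => /eqP; rewrite onee_eq0.
  rewrite -[RHS](integral_set1 (EFin \o f) a) [RHS]integral_mkcond.
  apply: eq_integral => x _; rewrite patchE; case: ifPn => // /negP xa.
  have [/negP/negPn/eqP xa'|/negP] := h x; first by case: xa; rewrite xa' inE.
  by rewrite -leNgt => fx; congr (_%:E); apply/eqP; rewrite eq_le fx f0.
have [p _ fp] := int1 0; have [q qp fq] := int1 p.
have [pq|pq] := ltP p q; first by exists p, q.
by exists q, p; split => //; rewrite lt_neqAle qp.
Qed.

(** The bound relative to a single point [p] degenerates near [p]. With two points [p < q], every
    [x] is at distance at least [(q - p) / 2] from one of them. *)
Lemma log_concave_bounded : exists M, forall x, f x <= M.
Proof.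
have [p [q [pq fp fq]]] := log_concave_two_points.
pose l := (q - p) / 2.
pose B r := Num.max (f r) (4 / (f r * l ^+ 2)).
have l0 : 0 < l by rewrite divr_gt0// subr_gt0.
have away r x : 0 < f r -> l <= `|x - r| -> f x <= B r.
  move=> fr lxr.
  have rx : r != x.
    apply/eqP => rx; move: lxr; rewrite rx subrr normr0; lra.
  rewrite (le_trans (log_concave_bound_away rx fr))// ge_max !le_max lexx/=.
  have xr2 : 0 < (x - r) ^+ 2 by rewrite exprn_even_gt0//= subr_eq0 eq_sym.
  have l2 : 0 < l ^+ 2 by exact: exprn_gt0.
  apply/orP; right; rewrite ler_pM2l// lef_pV2 ?posrE; last 2 first.
  - exact: mulr_gt0.
  - exact: mulr_gt0.
  by rewrite ler_pM2l// -(real_normK (num_real (x - r))) lerXn2r// nnegrE ltW.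
exists (Num.max (B p) (B q)) => x; rewrite le_max.
have [xl|xl] := leP l (x - p).
  by rewrite away//= (le_trans xl)// ler_norm.
rewrite (away q) ?orbT// -normrN (le_trans _ (ler_norm _))//; rewrite /l in xl *; lra.
Qed.

End log_concave_functions.

(** * Comparing products of integrals through symmetrized double integrals *)

Section symmetrization.
Context {R : realType}.
Local Notation mR := (measurableTypeR R).
Local Notation mu := (@lebesgue_measure R).

(* The hypothesis is symmetrized because in the application
   [p s * q t <= u s * v t] holds for [s <= t] only. *)
Lemma le_integral_mul_sym (p q u v : R -> R) :
  measurable_fun setT p -> measurable_fun setT q ->
  measurable_fun setT u -> measurable_fun setT v ->
  (forall s, 0 <= p s) -> (forall s, 0 <= q s) ->
  (forall s, 0 <= u s) -> (forall s, 0 <= v s) ->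
  (forall s t, p s * q t + p t * q s <= u s * v t + u t * v s) ->
  (\int[mu]_s (p s)%:E * \int[mu]_s (q s)%:E <=
   \int[mu]_s (u s)%:E * \int[mu]_s (v s)%:E)%E.
Proof.
move=> mp mq mu_ mv p0 q0 u0 v0 H.
(* The iterated integral of a symmetrized product is twice the product of the integrals.
   Nonnegativity makes this valid for infinite integrals too. *)
have dbl (a b : R -> R) : measurable_fun setT a -> measurable_fun setT b ->
    (forall s, 0 <= a s) -> (forall s, 0 <= b s) ->
    (\int[mu]_s \int[mu]_t (a s * b t + a t * b s)%:E =
      2%:E * (\int[mu]_s (a s)%:E * \int[mu]_s (b s)%:E))%E.
  move=> ma mb a0 b0.
  have /measurable_EFinP Ma := ma; have /measurable_EFinP Mb := mb.
  pose A := (\int[mu]_s (a s)%:E)%E; pose B := (\int[mu]_s (b s)%:E)%E.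
  have A0 : (0 <= A)%E by apply: integral_ge0 => s _; rewrite lee_fin.
  have B0 : (0 <= B)%E by apply: integral_ge0 => s _; rewrite lee_fin.
  transitivity (\int[mu]_s ((a s)%:E * B + A * (b s)%:E))%E.
    apply: eq_integral => s _.
    under eq_integral do rewrite EFinD !EFinM.
    rewrite ge0_integralD//=; last 4 first.
    - by move=> t _; rewrite mule_ge0// lee_fin.
    - exact: measurable_funeM.
    - by move=> t _; rewrite mule_ge0// lee_fin.
    - by apply: emeasurable_funM.
    by rewrite ge0_integralZl ?ge0_integralZr ?lee_fin// => t _; rewrite lee_fin.
  rewrite ge0_integralD//=; last 4 first.
  - by move=> t _; rewrite mule_ge0// lee_fin.
  - by apply: emeasurable_funM.
  - by move=> t _; rewrite mule_ge0// lee_fin.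
  - by apply: emeasurable_funM.
  rewrite ge0_integralZl ?ge0_integralZr//; try by move=> t _; rewrite lee_fin.
  by rewrite -/A -/B mule_natl mule2n.
rewrite -(@lee_pmul2l _ 2%:E)// -!dbl//.
have mm (a b : R -> R) : measurable_fun setT a -> measurable_fun setT b ->
    measurable_fun setT (fun z : mR * mR => (a z.1 * b z.2 + a z.2 * b z.1)%:E).
  move=> ma mb; apply/measurable_EFinP.
  by apply: measurable_funD; apply: measurable_funM; apply: measurableT_comp.
have ge (a b : R -> R) : (forall s, 0 <= a s) -> (forall s, 0 <= b s) ->
    forall s t, (0 <= (a s * b t + a t * b s)%:E)%E.
  by move=> a0 b0 s t; rewrite lee_fin addr_ge0// mulr_ge0.
apply: ge0_le_integral => //.
- by move=> s _; apply: integral_ge0 => t _; exact: ge.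
- apply: (measurable_fun_fubini_tonelli_F
    (fun z : mR * mR => (p z.1 * q z.2 + p z.2 * q z.1)%:E)); first exact: mm.
  by move=> z; exact: ge.
- apply: (measurable_fun_fubini_tonelli_F
    (fun z : mR * mR => (u z.1 * v z.2 + u z.2 * v z.1)%:E)); first exact: mm.
  by move=> z; exact: ge.
move=> s _; apply: ge0_le_integral => //.
- by move=> t _; exact: ge.
- exact: measurableT_comp (mm p q mp mq) (pair1_measurable s).
- exact: measurableT_comp (mm u v mu_ mv) (pair1_measurable s).
- by move=> t _; rewrite lee_fin.
Qed.

End symmetrization.

(** * Integrals of product densities along the diagonal and their MTP2 inequality *)

Section location_mixture.
Context {R : realType} {d : nat}.
Variable f : 'I_d -> R -> R.
Hypothesis f0 : forall i x, 0 <= f i x.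
Hypothesis mf : forall i, measurable_fun setT (f i).
Hypothesis lcf : forall i, log_concave (f i).
Hypothesis intf : forall i, (\int[lebesgue_measure]_x (f i x)%:E = 1)%E.
Implicit Types x y : d.-tuple R.

(** When the [f i] are the densities of independent variables, this is their joint density along the
    diagonal line through [x]. Its integral [diag_marginal] is the function h of the overview. *)
Definition shifted_prod x (s : R) : R := \prod_(i < d) f i (tnth x i + s).
Definition diag_marginal x : \bar R := (\int[lebesgue_measure]_s (shifted_prod x s)%:E)%E.

Lemma shifted_prod_ge0 x s : 0 <= shifted_prod x s.
Proof. exact: prodr_ge0. Qed.

Lemma shifted_prodE x s : shifted_prod x s = \prod_(i < d) f i (tnth (tshift x s) i).
Proof. by apply: eq_bigr => i _; rewrite tnth_mktuple. Qed.

Lemma measurable_shifted_prod_pair :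
  measurable_fun setT (fun z : d.-tuple R * measurableTypeR R => shifted_prod z.1 z.2).
Proof.
rewrite (_ : (fun _ => _) =
    (fun y : d.-tuple R => \prod_(i < d) f i (tnth y i)) \o (fun z => tshift z.1 z.2)).
  apply: measurableT_comp; first exact: measurable_tuple_prod.
  exact: measurable_tshift.
by apply/funext => z /=; rewrite shifted_prodE.
Qed.

Lemma measurable_shifted_prod x : measurable_fun setT (shifted_prod x).
Proof. exact: measurableT_comp measurable_shifted_prod_pair (pair1_measurable x). Qed.

Lemma measurable_diag_marginal : measurable_fun setT diag_marginal.
Proof.
apply: (measurable_fun_fubini_tonelli_F
  (fun z : d.-tuple R * measurableTypeR R => (shifted_prod z.1 z.2)%:E)).
  by apply/measurable_EFinP; exact: measurable_shifted_prod_pair.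
by move=> z; rewrite lee_fin shifted_prod_ge0.
Qed.

Lemma diag_marginal_ge0 x : (0 <= diag_marginal x)%E.
Proof. by apply: integral_ge0 => s _; rewrite lee_fin shifted_prod_ge0. Qed.

Lemma diag_marginal_tshift x u : diag_marginal (tshift x u) = diag_marginal x.
Proof.
rewrite /diag_marginal -[RHS](ge0_integral_shift u); last 2 first.
- by apply/measurable_EFinP; exact: measurable_shifted_prod.
- by move=> s; rewrite lee_fin shifted_prod_ge0.
apply: eq_integral => s _; congr (_%:E); apply: eq_bigr => i _.
by rewrite tnth_mktuple (addrC s) addrA.
Qed.

(** All factors except the [k]-th are bounded by constants, and the [k]-th has integral 1. The index
    [k] also excludes [d = 0], where the empty product 1 has infinite integral over the line. *)
Lemma diag_marginal_fin_num x (k : 'I_d) : diag_marginal x \is a fin_num.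
Proof.
have /choice[M fM] i : exists M, forall r, f i r <= M.
  exact: log_concave_bounded.
rewrite ge0_fin_numE ?diag_marginal_ge0//.
pose K := \prod_(i < d | i != k) M i.
have M0 i : 0 <= M i by exact: le_trans (f0 i 0) (fM i 0).
have mfk : measurable_fun setT (fun s => (f k (tnth x k + s))%:E).
  by apply/measurable_EFinP; apply: measurableT_comp => //; exact: measurable_funD.
apply: (@le_lt_trans _ _ (\int[lebesgue_measure]_s (K%:E * (f k (tnth x k + s))%:E))%E).
  apply: ge0_le_integral => //.
  - by move=> s _; rewrite lee_fin shifted_prod_ge0.
  - by apply/measurable_EFinP; exact: measurable_shifted_prod.
  - exact: measurable_funeM.
  - move=> s _; rewrite -EFinM lee_fin /shifted_prod (bigD1 k)//= mulrC.
    by rewrite ler_wpM2r// ler_prod// => i _; rewrite f0 fM.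
rewrite ge0_integralZl//; last 2 first.
- by move=> s _; rewrite lee_fin.
- by rewrite lee_fin prodr_ge0.
under eq_integral do rewrite addrC.
rewrite (ge0_integral_shift _ (f := EFin \o f k)) ?intf//; last 2 first.
- exact/measurable_EFinP.
- by move=> s; rewrite lee_fin.
by rewrite mule1 ltry.
Qed.

Lemma shifted_prod_max_min x y s :
  shifted_prod x s * shifted_prod y s =
  shifted_prod (tmax x y) s * shifted_prod (tmin x y) s.
Proof.
rewrite /shifted_prod -!big_split/=; apply: eq_bigr => i _; rewrite !tnth_mktuple.
by have [_|_] := leP (tnth x i) (tnth y i); rewrite // mulrC.
Qed.

(** The comparison is made factor by factor. If [tnth y i < tnth x i] the factors agree; otherwise
    [log_concave_mul] applies, with smallest point [tnth x i + s] and largest point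
    [tnth y i + t]. *)
Lemma shifted_prod_cross x y s t : s <= t ->
  shifted_prod x s * shifted_prod y t <=
  shifted_prod (tmax x y) s * shifted_prod (tmin x y) t.
Proof.
move=> st; rewrite /shifted_prod -!big_split/=; apply: ler_prod => i _.
rewrite mulr_ge0//= !tnth_mktuple.
have [xy|//] := leP (tnth x i) (tnth y i).
by apply: log_concave_mul => //; lra.
Qed.

Lemma tmaxC x y : tmax x y = tmax y x.
Proof. by apply: eq_from_tnth => i; rewrite !tnth_mktuple maxC. Qed.

Lemma tminC x y : tmin x y = tmin y x.
Proof. by apply: eq_from_tnth => i; rewrite !tnth_mktuple minC. Qed.

(** For [s <= t], write the claim as [a + b <= c + e]. The cross inequality, used for [x, y] and for
    [y, x], gives [a <= c] and [b <= c]; exchanging maxima and minima at equal shifts gives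
    [a * b = c * e]. These relations imply the claim. *)
Lemma shifted_prod_sym x y s t :
  shifted_prod x s * shifted_prod y t + shifted_prod x t * shifted_prod y s <=
  shifted_prod (tmax x y) s * shifted_prod (tmin x y) t +
  shifted_prod (tmax x y) t * shifted_prod (tmin x y) s.
Proof.
wlog st : s t / s <= t => [H|].
  have [/H//|/ltW/H] := leP s t.
  by rewrite addrC [leRHS]addrC.
have ac := shifted_prod_cross x y st.
have bc := shifted_prod_cross y x st.
rewrite tmaxC tminC in bc.
have es := shifted_prod_max_min x y s.
have et := shifted_prod_max_min x y t.
have x_s := shifted_prod_ge0 x s; have x_t := shifted_prod_ge0 x t.
have y_s := shifted_prod_ge0 y s; have y_t := shifted_prod_ge0 y t.
have M_s := shifted_prod_ge0 (tmax x y) s; have M_t := shifted_prod_ge0 (tmax x y) t.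
have m_s := shifted_prod_ge0 (tmin x y) s; have m_t := shifted_prod_ge0 (tmin x y) t.
rewrite [shifted_prod y s * _]mulrC in bc.
set a := shifted_prod x s * shifted_prod y t in ac *.
set b := shifted_prod x t * shifted_prod y s in bc *.
set c := shifted_prod (tmax x y) s * shifted_prod (tmin x y) t in ac bc *.
set e := shifted_prod (tmax x y) t * shifted_prod (tmin x y) s.
have abce : a * b = c * e.
  transitivity ((shifted_prod x s * shifted_prod y s) *
                (shifted_prod x t * shifted_prod y t)); first by rewrite /a /b; ring.
  by rewrite es et /c /e; ring.
have a0 : 0 <= a by rewrite mulr_ge0.
have b0 : 0 <= b by rewrite mulr_ge0.
have e0 : 0 <= e by rewrite mulr_ge0.
have [c0|c0] := leP c 0; first by lra.
(* [c * (c + e - a - b) = (c - a) * (c - b)] *)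
rewrite -(ler_pM2l c0).
have : 0 <= (c - a) * (c - b) by rewrite mulr_ge0// subr_ge0.
rewrite mulrBl !mulrBr !mulrDr abce; lra.
Qed.

Lemma diag_marginal_MTP2 x y :
  (diag_marginal x * diag_marginal y <=
   diag_marginal (tmax x y) * diag_marginal (tmin x y))%E.
Proof.
apply: le_integral_mul_sym; do ?exact: measurable_shifted_prod.
all: try exact: shifted_prod_ge0.
exact: shifted_prod_sym.
Qed.

End location_mixture.

(** * Homogeneity of multivariate Pareto distributions *)

Section exponential_tail_ratio.
Context {R : realType}.

Lemma exponential_prob_gt (u : R) : 0 < u ->
  exponential_prob 1 `]u, +oo[ = (expR (- u))%:E.
Proof.
move=> u0.
have mpdf : measurable_fun setT (fun x : R => (exponential_pdf 1 x)%:E).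
  by apply/measurable_EFinP; exact: measurable_exponential_pdf.
have pdf0 (x : R) : (0 <= (exponential_pdf 1 x)%:E)%E.
  by rewrite lee_fin exponential_pdf_ge0.
have := @integral_exponential_pdf R 1 ltr01.
rewrite -(setUv `]u, +oo[%classic) ge0_integral_setU//; last 3 first.
- exact: measurableC.
- exact: measurable_funTS.
- exact/disj_setPCl.
rewrite setCitvr.
(* The exponential density vanishes on negative numbers, so the half-line may be replaced by
   [[0, u]], whose probability is known in closed form. *)
have -> : (\int[lebesgue_measure]_(x in `]-oo, u]) (exponential_pdf 1 x)%:E =
    exponential_prob 1 `[0%R, u])%E.
  rewrite /exponential_prob integral_mkcond [RHS]integral_mkcond; apply: eq_integral => x _.
  rewrite !patchE !mem_setE !in_itv/=.
  case: ifPn => xu; last by rewrite andbF.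
  by rewrite andbT; case: ifPn => //; rewrite -ltNge => /lt0_exponential_pdf ->.
rewrite exponential_prob_itv0c// mulN1r -/(exponential_prob 1 _).
case: (exponential_prob 1 _) => // r; rewrite -EFinB -EFinD => -[h].
by congr (_%:E); lra.
Qed.

(** The logarithms of the ratios telescope. Their Cesaro means tend to [ln q], but they equal
    [(ln (b n.+1) - ln (b 0)) / n.+1], whose absolute value is at most [ln D / n.+1]. *)
Lemma cvg_ratio_bounded (b : R^nat) (D q : R) :
  (forall n, 1 <= b n <= D) -> (b n.+1 / b n) @[n --> \oo] --> q -> q = 1.
Proof.
move=> bD bq.
have b0 n : 0 < b n by have /andP[+ _] := bD n; exact: lt_le_trans.
have D0 : 0 < D by have /andP[_] := bD 0%N; exact: lt_le_trans.
(* Continuity of [ln] at [q] requires [q] to be positive; every ratio is at least [D^-1]. *)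
have q0 : 0 < q.
  apply: (@lt_le_trans _ _ D^-1); first by rewrite invr_gt0.
  rewrite -(cvg_lim _ bq)//; apply: limr_ge; first by apply/cvg_ex; exists q.
  near=> n; have /andP[b1 _] := bD n.+1; have /andP[_ b2] := bD n.
  rewrite -[D^-1]mul1r ler_pM// ?invr_ge0 ?(ltW D0)//.
  by rewrite lef_pV2 ?posrE.
have lnbq : telescope (fun n => ln (b n)) @ \oo --> ln q.
  rewrite (_ : telescope _ = fun n => ln (b n.+1 / b n)); last first.
    by apply/funext => n; rewrite /telescope/= ln_div ?posrE.
  by apply: continuous_cvg => //; exact: continuous_ln.
have /cesaro := lnbq.
have -> : arithmetic_mean (telescope (fun n => ln (b n))) =
    (fun n => n.+1%:R^-1 * (ln (b n.+1) - ln (b 0%N))).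
  by rewrite /arithmetic_mean telescopeK.
have b_small : (n.+1%:R^-1 * (ln (b n.+1) - ln (b 0%N))) @[n --> \oo] --> (0 : R).
  apply: (@squeeze_cvgr _ _ _ _ (fun n => harmonic n * - ln D) (fun n => harmonic n * ln D)).
  - near=> n; rewrite /harmonic/=.
    have lnb m : 0 <= ln (b m) <= ln D.
      have /andP[b1 b2] := bD m; rewrite ln_ge0//=.
      by rewrite ler_ln ?posrE.
    have /andP[? ?] := lnb n.+1; have /andP[? ?] := lnb 0%N.
    by apply/andP; split; rewrite ler_pM2l ?invr_gt0//; lra.
  - by rewrite -[X in _ --> X](mul0r (- ln D)); apply: cvgMr_tmp; exact: cvg_harmonic.
  - by rewrite -[X in _ --> X](mul0r (ln D)); apply: cvgMr_tmp; exact: cvg_harmonic.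
move=> lnq; have lnq0 : ln q = 0.
  by rewrite -(cvg_lim _ lnq)// (cvg_lim _ b_small).
by apply: ln_inj; rewrite ?posrE// lnq0 ln1.
Unshelve. all: by end_near. Qed.

Lemma cvg_exponential_tail_ratio (a : R -> R) (D G t : R) : 0 < t ->
  (forall u, 0 < u -> expR (- u) <= a u <= D * expR (- u)) ->
  (a (u + t) / a u) @[u --> +oo] --> G -> G = expR (- t).
Proof.
move=> t0 aD aG.
(* Sampling along multiples of [t] and removing the exponential decay leaves a sequence in [[1, D]]
   with ratios tending to [G * expR t]. The successor keeps the argument of [a] positive. *)
pose b n := a (n.+1%:R * t) * expR (n.+1%:R * t).
have nt0 n : 0 < n.+1%:R * t by rewrite mulr_gt0.
have a0 u : 0 < u -> 0 < a u.
  by move=> /aD/andP[+ _]; apply: lt_le_trans; exact: expR_gt0.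
have bD n : 1 <= b n <= D.
  have /andP[h1 h2] := aD _ (nt0 n).
  rewrite /b; set v := _ * t in h1 h2 *; have v0 := expR_gt0 v.
  have vN : expR (- v) * expR v = 1 by rewrite mulrC expRxMexpNx_1.
  by rewrite -vN ler_pM2r// h1/= -[D]mulr1 -vN mulrA ler_pM2r.
suff /(cvg_ratio_bounded bD) h : (b n.+1 / b n) @[n --> \oo] --> G * expR t.
  by rewrite -[LHS]mulr1 -(expRxMexpNx_1 t) mulrA h mul1r.
rewrite (_ : (fun n => _) = fun n => a (n.+1%:R * t + t) / a (n.+1%:R * t) * expR t).
  apply: cvgMr_tmp; apply: (cvg_comp (fun n => n.+1%:R * t) (fun u => a (u + t) / a u)).
    2: exact: aG.
  apply/cvgryPge => A; near=> n.
  rewrite -ler_pdivrMr// (@le_trans _ _ n%:R)//; first by near: n; exact: nbhs_infty_ger.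
  by rewrite ler_nat.
apply/funext => n; rewrite /b -natr1 mulrDl mul1r expRD.
by field; rewrite !gt_eqF ?expR_gt0 ?a0.
Unshelve. all: by end_near. Qed.

End exponential_tail_ratio.

(** * Shifting a multivariate Pareto law along the diagonal *)

Section homogeneity.
Context {R : realType} {d : nat}.
Implicit Types (x y z : d.-tuple R) (u t : R).
Local Notation T := (d.-tuple R).

Lemma tshiftD x u t : tshift (tshift x u) t = tshift x (u + t).
Proof. by apply: eq_from_tnth => i; rewrite !tnth_mktuple addrA. Qed.

Lemma tshift0 x : tshift x 0 = x.
Proof. by apply: eq_from_tnth => i; rewrite !tnth_mktuple addr0. Qed.

Lemma measurable_max_gt u : measurable [set x : T | max_gt u x].
Proof.
rewrite (_ : mkset _ = \bigcup_(i in [set: 'I_d])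
    ((fun x : T => tnth x i) @^-1` `]u, +oo[)).
  apply: fin_bigcup_measurable => // i _; rewrite -[X in measurable X]setTI.
  exact: measurable_tnth.
apply/seteqP; split => x /=.
  by move=> [i xi]; exists i => //=; rewrite in_itv/= xi.
by move=> [i _ /=]; rewrite in_itv/= andbT => xi; exists i.
Qed.

(** Capping the corner at 0 adds to [tle x (tshift z (u + t))] the requirement that no coordinate of
    [x] exceeds [u + t]. Removing the capped orthant therefore leaves the points with maximum above
    [u + t]. *)
Definition orthant0 z : T := tmin z [tuple 0 | i < d].

Lemma orthant_gtD z u t : 0 < t ->
  ([set x | tle x (tshift z (u + t))] `&` [set x | max_gt u x]) `\`
  ([set x | tle x (tshift (orthant0 z) (u + t))] `&` [set x | max_gt u x]) =
  [set x | tle x (tshift z (u + t))] `&` [set x | max_gt (u + t) x].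
Proof.
move=> t0; apply/seteqP; split => x /=.
  move=> [[xz xu] h]; split => //; apply: contrapT => xut; apply: h; split => // i.
  rewrite !tnth_mktuple; have := xz i; rewrite tnth_mktuple.
  have [//|_ _] := leP (tnth z i) 0.
  by rewrite add0r leNgt; apply/negP => h; apply: xut; exists i.
move=> [xz [i xi]]; split.
  by split => //; exists i; rewrite (lt_trans _ xi)// ltrDl.
move=> [/(_ i) + _]; rewrite !tnth_mktuple => xi'.
have : Num.min (tnth z i) 0 <= 0 by rewrite ge_min lexx orbT.
lra.
Qed.

Lemma orthant0_tshift_calL z t : calL z -> 0 < t -> calL (tshift (orthant0 z) t).
Proof.
move=> [i zi] t0; exists i; rewrite !tnth_mktuple.
by rewrite min_r ?ltW// add0r.
Qed.

Lemma measurable_tnth_gt i u : measurable [set x : T | u < tnth x i].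
Proof.
rewrite (_ : mkset _ = (fun x : T => tnth x i) @^-1` `]u, +oo[); last first.
  by apply/seteqP; split => x /=; rewrite in_itv/= andbT.
by rewrite -[X in measurable X]setTI; exact: measurable_tnth.
Qed.

Section limit.
Context dX (Omega : measurableType dX) (P : probability Omega R).
Variable X : {RV P >-> T}.
Hypothesis expX : forall i, std_exponential P (fun w => tnth (X w) i).
Hypothesis d0 : (0 < d)%N.

Let a u := fine (P (X @^-1` [set x | max_gt u x])).

Let mX (A : set T) : measurable A -> measurable (X @^-1` A).
Proof. by move=> mA; rewrite -[X in measurable X]setTI; exact: measurable_funPT. Qed.

Let tail i u : 0 < u -> P (X @^-1` [set x | u < tnth x i]) = (expR (- u))%:E.
Proof.
move=> u0; rewrite -exponential_prob_gt// -(expX i)//; congr (P _).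
by apply/seteqP; split => w /=; rewrite in_itv/= andbT.
Qed.

Lemma max_gt_tail_ge u : 0 < u -> expR (- u) <= a u.
Proof.
move=> u0; rewrite -lee_fin fineK ?fin_num_measure//; last by apply: mX; exact: measurable_max_gt.
rewrite -(tail (Ordinal d0))//; apply: le_measure; rewrite ?inE.
- by apply: mX; exact: measurable_tnth_gt.
- by apply: mX; exact: measurable_max_gt.
- by move=> w /= h; exists (Ordinal d0).
Qed.

(** This is the union bound over the [d] exponential coordinates. *)
Lemma max_gt_tail_le u : 0 < u -> a u <= d%:R * expR (- u).
Proof.
move=> u0; rewrite -lee_fin fineK ?fin_num_measure//; last by apply: mX; exact: measurable_max_gt.
have -> : X @^-1` [set x | max_gt u x] =
    \big[setU/set0]_(i < d) (X @^-1` [set x | u < tnth x i]).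
  rewrite -bigcup_seq; apply/seteqP; split => w /=.
    by move=> [i h]; exists i => //=; rewrite mem_index_enum.
  by move=> [i _ h]; exists i.
apply: (@le_trans _ _ (\sum_(i < d) P (X @^-1` [set x | (u < tnth x i)%R]))%E).
  elim: (index_enum _) => [|i s IH]; first by rewrite !big_nil measure0.
  rewrite !big_cons (le_trans (measureU2 _ _ _))//.
  - by apply: mX; exact: measurable_tnth_gt.
  - by apply: bigsetU_measurable => j _; apply: mX; exact: measurable_tnth_gt.
  - by rewrite leeD2l.
under eq_bigr do rewrite tail//.
by rewrite sumEFin sumr_const card_ord lee_fin mulr_natl.
Qed.

Section cvg.
Variable F : T -> R.
Hypothesis XF : forall z, calL z ->
  cond_prob P [set w | tle (tshift (X w) (- u)) z] [set w | max_gt u (X w)]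
    @[u --> +oo] --> F z.

Let m (A : set T) := fine (P (X @^-1` A)).

Let mgt u z := m ([set x | tle x (tshift z u)] `&` [set x | max_gt u x]).

Let cond_probE u z :
  cond_prob P [set w | tle (tshift (X w) (- u)) z] [set w | max_gt u (X w)] =
  mgt u z / a u.
Proof.
rewrite /cond_prob /mgt /m /a; congr (fine (P _) / _).
apply/seteqP; split => w /= [h ?]; split => // i; have := h i;
  by rewrite !tnth_mktuple lerBlDr.
Qed.

Let a0 u : 0 < u -> 0 < a u.
Proof. by move=> /max_gt_tail_ge; apply: lt_le_trans; exact: expR_gt0. Qed.

Let cvg_mgt z : calL z -> (mgt u z / a u) @[u --> +oo] --> F z.
Proof. by move/XF; under eq_fun do rewrite cond_probE. Qed.

Let mD A B : measurable A -> measurable B -> B `<=` A -> m (A `\` B) = m A - m B.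
Proof.
move=> mA mB BA; rewrite /m -[X @^-1` _]/((X @^-1` A) `\` (X @^-1` B)) measureD; last 3 first.
- exact: mX.
- exact: mX.
- by rewrite -ge0_fin_numE// fin_num_measure//; exact: mX.
rewrite setIidr; last exact: preimage_subset.
by rewrite fineB// fin_num_measure//; exact: mX.
Qed.

Let mset u z : measurable ([set x | tle x z] `&` [set x | max_gt u x] : set T).
Proof. by apply: measurableI; [exact: measurable_tle|exact: measurable_max_gt]. Qed.

Let cvg_addr_pinfty t : (u + t) @[u --> +oo] --> +oo.
Proof.
apply/cvgryPge => A; near=> u; rewrite -lerBlDr; near: u.
apply: nbhs_pinfty_ge; exact: num_real.
Unshelve. all: by end_near. Qed.

(** For the corner [(t,...,t)], the points above level [u] outside the shifted orthant are exactly
    those above level [u + t]. Hence the ratio converges to [1 - F z], and the two tail bounds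
    identify this limit. *)
Lemma cvg_max_gt_ratio t : 0 < t -> (a (u + t) / a u) @[u --> +oo] --> expR (- t).
Proof.
move=> t0; pose z : T := [tuple t | i < d].
have zL : calL z by exists (Ordinal d0); rewrite tnth_mktuple.
have aF : (a (u + t) / a u) @[u --> +oo] --> 1 - F z.
  apply: (cvg_trans _ (cvgB (cvg_cst (1 : R)) (cvg_mgt zL))); apply: near_eq_cvg.
  near=> u; have u0 : 0 < u by near: u; apply: nbhs_pinfty_gt; exact: num_real.
  suff aE : a (u + t) = a u - mgt u z.
    by rewrite aE mulrBl divff// gt_eqF ?a0.
  rewrite /a -!/(m _) -mD//; last exact: measurable_max_gt.
  congr m; apply/seteqP; split => x /=.
    move=> [i xi]; split; first by exists i; rewrite (lt_trans _ xi)// ltrDl.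
    by move=> [/(_ i) + _]; rewrite !tnth_mktuple leNgt addrC xi.
  move=> [[i xi] h]; apply: contrapT => xut; apply: h; split; last by exists i.
  move=> j; rewrite !tnth_mktuple leNgt; apply/negP => tj; apply: xut.
  by exists j; rewrite addrC.
have <- // := cvg_exponential_tail_ratio t0 _ aF (D := d%:R).
by move=> u u0; rewrite max_gt_tail_ge//; exact: max_gt_tail_le.
Unshelve. all: by end_near. Qed.

(** By [orthant_gtD] the difference of the two probabilities at level [u] is the probability for [z]
    at level [u + t]. Dividing by [a u] and inserting [a (u + t)] separates a factor tending to
    [F z] from one tending to [expR (- t)]. *)
Lemma limit_homogeneous z t : calL z -> 0 < t ->
  F (tshift z t) - F (tshift (orthant0 z) t) = F z * expR (- t).
Proof.
move=> zL t0.
have ztL : calL (tshift z t).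
  by case: zL => i zi; exists i; rewrite tnth_mktuple addr_gt0.
have c1 := cvgB (cvg_mgt ztL) (cvg_mgt (orthant0_tshift_calL zL t0)).
have c2 : (mgt (u + t) z / a (u + t)) @[u --> +oo] --> F z.
  exact: (cvg_comp _ _ (cvg_addr_pinfty t) (cvg_mgt zL)).
have c3 := cvgM c2 (cvg_max_gt_ratio t0).
suff c13 : (mgt (u + t) z / a (u + t) * (a (u + t) / a u)) @[u --> +oo] -->
    F (tshift z t) - F (tshift (orthant0 z) t).
  exact: (cvg_unique (@Rhausdorff R) c13 (c3 _)).
apply: (cvg_trans _ (c1 _)); apply: near_eq_cvg.
near=> u; have u0 : 0 < u by near: u; apply: nbhs_pinfty_gt; exact: num_real.
have ut0 : 0 < u + t by rewrite addr_gt0.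
rewrite /= mulrA divfK ?gt_eqF ?a0// .
suff -> : mgt (u + t) z = mgt u (tshift z t) - mgt u (tshift (orthant0 z) t).
  by rewrite mulrBl.
rewrite /mgt !tshiftD (addrC t u) -mD ?orthant_gtD// => x [xz xu]; split => // i.
rewrite (le_trans (xz i))// !tnth_mktuple lerD2r.
by rewrite ge_min lexx.
Unshelve. all: by end_near. Qed.

End cvg.

End limit.


Lemma probability_setI_full dO (Omega : measurableType dO) (P : probability Omega R)
    (A B : set Omega) :
  measurable A -> measurable B -> P B = 1%E -> P (A `&` B) = P A.
Proof.
move=> mA mB PB.
rewrite (measureDI P mA mB) -[LHS]add0e; congr (_ + _)%E.
apply/esym/eqP; rewrite -measure_le0 (@le_trans _ _ (P (~` B)))//.
  by apply: le_measure; rewrite ?inE; [exact: measurableD|exact: measurableC|move=> x []].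
by rewrite probability_setC// PB subee.
Qed.

(** The shifted law restricted to [calL] is compared with the scaled law on lower orthants. For
    corners in [calL] this is [limit_homogeneous]; any other orthant misses [calL], so both measures
    vanish on it. *)
Lemma multivariate_pareto_homogeneous dO (Omega : measurableType dO)
    (P : probability Omega R) (Y : {RV P >-> T}) (t : R) (A : set T) :
  (0 < d)%N -> multivariate_pareto Y -> 0 < t -> measurable A -> A `<=` calL ->
  distribution P Y [set x | A (tshift x (- t))] =
  ((expR (- t))%:E * distribution P Y A)%E.
Proof.
move=> d0 [YL [dX [OX [PX [X [expX XY]]]]]] t0 mA AL.
have mshift : measurable_fun setT (fun x : T => tshift x (- t)).
  exact: measurable_tshift.
have mL : measurable (calL : set T) by exact: measurable_max_gt.
have mY B : measurable B -> measurable (Y @^-1` B).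
  by move=> mB; rewrite -[X in measurable X]setTI; exact: measurable_funPT.
pose shiftP := measure_function_pushforward__canonical__measure_function_Measure
  (distribution P Y) mshift.
pose m1 : {measure set T -> \bar R} := mrestr shiftP mL.
pose m2 : {measure set T -> \bar R} :=
  mscale (NngNum (expR_ge0 (- t))) (distribution P Y).
have YI B : measurable B -> P (Y @^-1` (B `&` calL)) = P (Y @^-1` B).
  by move=> mB; apply: probability_setI_full => //; exact: mY.
suff m12 : same_law m1 m2.
  by have := m12 _ mA; rewrite /m1/= /mrestr setIidl.
apply: tuple_measure_unique => z; last first.
  apply: (@le_lt_trans _ _ 1%E _ _ (probability_le1 P _)); last exact: ltry.
  apply: mY; rewrite -[X in measurable X]setTI.
  exact: (mshift measurableT _ (measurableI _ _ (measurable_tle z) mL)).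
have mtle y : measurable [set x : T | tle x y] by exact: measurable_tle.
have [zL|zL] := pselect (calL z); last first.
  have z0 : [set x : T | tle x z] `&` calL = set0.
    rewrite -subset0 => x /= [xz [i xi]]; apply: zL; exists i.
    exact: lt_le_trans (xz i).
  have Pz : distribution P Y [set x | tle x z] = 0%E.
    by rewrite -[LHS]YI// z0 preimage_set0 measure0.
  rewrite /m1/= /mrestr z0 /pushforward preimage_set0 measure0.
  by rewrite -[RHS]/((expR (- t))%:E * distribution P Y _)%E Pz mule0.
have := limit_homogeneous expX d0 XY zL t0.
set S1 := [set x : T | tle x (tshift z t)] `&` calL.
set S2 := [set x : T | tle x (tshift (orthant0 z) t)] `&` calL.
have mS1 : measurable S1 by exact: measurableI.
have mS2 : measurable S2 by exact: measurableI.
(* This is [orthant_gtD] at threshold [u = 0]. *)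
have S12 : S1 `\` S2 = (fun x => tshift x (- t)) @^-1` ([set x | tle x z] `&` calL).
  have := @orthant_gtD z 0 t t0; rewrite add0r => ->.
  apply/seteqP; split => x /= [xz [i xi]].
    split; last by exists i; rewrite tnth_mktuple subr_gt0.
    by move=> j; have := xz j; rewrite !tnth_mktuple lerBlDr.
  split; last by exists i; move: xi; rewrite tnth_mktuple subr_gt0.
  by move=> j; have := xz j; rewrite !tnth_mktuple lerBlDr.
have S21 : S2 `<=` S1.
  move=> x [xz xL]; split => // i; rewrite (le_trans (xz i))// !tnth_mktuple lerD2r.
  by rewrite ge_min lexx.
have F1 : P [set w | tle (Y w) (tshift z t)] = P (Y @^-1` S1) by rewrite YI.
have F2 : P [set w | tle (Y w) (tshift (orthant0 z) t)] = P (Y @^-1` S2) by rewrite YI.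
rewrite F1 F2 => FE.
have -> : m1 [set x | tle x z] = P (Y @^-1` (S1 `\` S2)) by rewrite S12.
rewrite -[Y @^-1` _]/((Y @^-1` S1) `\` (Y @^-1` S2)) measureD; last 3 first.
- exact: mY.
- exact: mY.
- by rewrite -ge0_fin_numE// fin_num_measure//; exact: mY.
rewrite setIidr; last exact: preimage_subset.
have finP B : measurable B -> P (Y @^-1` B) = (fine (P (Y @^-1` B)))%:E.
  by move=> mB; rewrite fineK// fin_num_measure//; exact: mY.
transitivity (P (Y @^-1` S1) - P (Y @^-1` S2))%E; first by [].
rewrite (finP S1)// (finP S2)// -EFinB FE mulrC EFinM.
by rewrite -[RHS]/((expR (- t))%:E * P (Y @^-1` [set x | tle x z]))%E finP.
Qed.

End homogeneity.

(** * Densities *)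

Section joint_density.
Local Open Scope ereal_scope.
Context {R : realType} {d : nat}.
Local Notation T := (d.-tuple R).
Context dO (Omega : measurableType dO) (P : probability Omega R).
Variables (U : 'I_d -> {RV P >-> R}) (f : 'I_d -> R -> R).
Hypothesis Uf : forall i, is_density lebesgue_measure (pushforward P (U i)) (f i).
Hypothesis indU : independent_family P (fun i w => U i w).

(** On a lower orthant, independence factors the left side and Tonelli factors the right side, with
    equal factors. *)
Lemma independent_family_density : same_law
  (pushforward P (fun w => [tuple U i w | i < d] : T))
  (fun A => \int[lebesgue_tuple (n:=d)]_(x in A) (\prod_(i < d) f i (tnth x i))%:E).
Proof.
have mf i : measurable_fun setT (f i) by have [] := Uf i.
have f0 i x : (0 <= f i x)%R by have [] := Uf i.
have mUt : measurable_fun setT (fun w => [tuple U i w | i < d] : T).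
  apply/measurable_fun_tnthP => i.
  rewrite (_ : _ \o _ = U i); first exact: measurable_funPT.
  by apply/funext => w; rewrite /= tnth_mktuple.
have mprod : measurable_fun setT
    (fun x : T => (\prod_(i < d) f i (tnth x i))%:E).
  by apply/measurable_EFinP; exact: measurable_tuple_prod.
have prod0 (x : T) : 0 <= (\prod_(i < d) f i (tnth x i))%:E.
  by rewrite lee_fin prodr_ge0.
have [nu nuE] := ge0_density_measure (lebesgue_tuple (n:=d)) mprod prod0.
rewrite -nuE.
pose m1 := measure_function_pushforward__canonical__measure_function_Measure P mUt.
have m1fin z : m1 [set x | tle x z] < +oo.
  apply: (@le_lt_trans _ _ 1 _ _ (probability_le1 P _)); last exact: ltry.
  rewrite -[X in measurable X]setTI.
  exact: (mUt measurableT _ (measurable_tle z)).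
suff : same_law m1 nu by [].
apply: tuple_measure_unique => // z; rewrite nuE.
pose I i : set R := `]-oo, tnth z i]%classic.
have mI i : measurable (I i) by exact: measurable_itv.
transitivity (\prod_(i < d) P (U i @^-1` I i)).
  have := indU mI.
  rewrite (_ : [set w | _] =
      (fun w => [tuple U i w | i < d]) @^-1` [set x : T | tle x z]); last first.
    apply/seteqP; split => w /= h i; have := h i;
      by rewrite /I/= in_itv/= ?tnth_mktuple.
  move=> PE; rewrite -[LHS]fineK; last by rewrite ge0_fin_numE// m1fin.
  rewrite [fine _]PE -prodEFin; apply: eq_bigr => i _.
  rewrite fineK// fin_num_measure//.
  by rewrite -[X in measurable X]setTI; exact: measurable_funPT.
(* The indicator of the orthant is split into coordinate indicators, which turns the integrand into
   a product of functions of one coordinate each. *)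
transitivity (\int[lebesgue_tuple (n:=d)]_x
    (\prod_(i < d) (f i (tnth x i) * \1_(I i) (tnth x i)))%:E).
  rewrite (@ge0_integral_tuple_prod R d (fun i x => f i x * \1_(I i) x)%R).
  - apply: eq_bigr => i _; have [_ _ UiE] := Uf i.
    transitivity (\int[lebesgue_measure]_(x in I i) (f i x)%:E).
      exact: (UiE _ (mI i)).
    rewrite integral_mkcond epatch_indic.
    by apply: eq_integral => x _; rewrite EFinM.
  - by move=> i; apply: measurable_funM.
  - by move=> i x; rewrite mulr_ge0.
rewrite [RHS]integral_mkcond epatch_indic; apply: eq_integral => x _.
rewrite big_split/= EFinM; congr (_ * _%:E).
rewrite indicE; case: (boolP (x \in _)) => [|/negP]; rewrite inE /= => xz.
  by rewrite big1// => i _; rewrite indicE mem_set// /I/= in_itv/=; exact: xz.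
have [i xi] : exists i, ~ (tnth x i <= tnth z i)%R.
  by apply/not_existsP => h; apply: xz => i; exact: contrapT (h i).
by rewrite (bigD1 i)//= indicE memNset ?mul0r// /I/= in_itv/=.
Qed.

End joint_density.

(** * The density of an extremal function plus an independent exponential shift *)

Section exponential_shift_density.
Local Open Scope ereal_scope.
Context {R : realType} {d : nat}.
Local Notation T := (d.-tuple R).
Local Notation leb := (lebesgue_tuple (n:=d) : set T -> \bar R).
Local Notation mu := (@lebesgue_measure R).
Local Notation mR := (measurableTypeR R).
Variables (f : 'I_d -> R -> R) (k : 'I_d).
Hypothesis f0 : forall i x, (0 <= f i x)%R.
Hypothesis mf : forall i, measurable_fun setT (f i).
Context dO (Omega : measurableType dO) (P : probability Omega R).
Variables (W : {RV P >-> T}) (E : {RV P >-> R}).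
Hypothesis expE : std_exponential P E.
Hypothesis indWE : independent P W E.

Let fV (v : T) := (\prod_(i < d) f i (tnth v i))%R.
(** This map sends [(U_1,...,U_d)] to the differences [U_i - U_k]; [lawW] below says that [W] is
    distributed as the image of a vector with density [fV]. *)
Let center (v : T) := tshift v (- tnth v k)%R.
Let g : R -> R := exponential_pdf 1.

Hypothesis lawW : same_law (distribution P W)
  (fun A => \int[leb]_(v in center @^-1` A) (fV v)%:E).

Let g0 x : (0 <= g x)%R. Proof. exact: exponential_pdf_ge0. Qed.
Let mg : measurable_fun setT g. Proof. exact: measurable_exponential_pdf. Qed.
Let fV0 v : (0 <= fV v)%R. Proof. exact: prodr_ge0. Qed.
Let mfV : measurable_fun setT fV. Proof. exact: measurable_tuple_prod. Qed.

Let mcenter : measurable_fun setT center.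
Proof.
apply: measurable_tshift => //.
by apply: measurableT_comp => //; exact: measurable_tnth.
Qed.

Let dens (z : T * mR) := (fV z.1)%:E * (g z.2)%:E.

Let mdens : measurable_fun setT dens.
Proof.
apply: emeasurable_funM; apply/measurable_EFinP.
  exact: (measurableT_comp mfV measurable_fst).
exact: (measurableT_comp mg measurable_snd).
Qed.

Let dens0 z : 0 <= dens z. Proof. by rewrite mule_ge0// lee_fin. Qed.

Let psi (z : T * mR) : T * mR := (center z.1, z.2).

Let mpsi : measurable_fun setT psi.
Proof.
by apply: measurable_fun_pair => //; exact: (measurableT_comp mcenter measurable_fst).
Qed.

(** The [k]-th coordinate of [W] is almost surely 0, so [W] has no Lebesgue density. The pair
    [(W, E)] is therefore described as the image under [psi] of a law that has one. *)
Let joint_law (S : set (T * mR)) : measurable S ->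
  P ((fun w => (W w, E w)) @^-1` S) =
  \int[(lebesgue_tuple (n:=d)) \x mu]_(z in psi @^-1` S) dens z.
Proof.
move=> mS.
have mWE : measurable_fun setT (fun w => (W w, E w) : T * mR).
  by apply: measurable_fun_pair; [exact: (measurable_funPT W)|exact: (measurable_funPT E)].
have [nu nuE] := ge0_density_measure ((lebesgue_tuple (n:=d)) \x mu) mdens dens0.
pose m1 := measure_function_pushforward__canonical__measure_function_Measure P mWE.
pose m2 := measure_function_pushforward__canonical__measure_function_Measure nu mpsi.
pose D1 : {sigma_finite_measure set T -> \bar R} := distribution P W.
have mE : measurable_fun setT (E : Omega -> mR) by exact: (measurable_funPT E).
pose ME := isMeasurableFun.Build _ _ _ _ _ mE.
pose E' : {mfun Omega >-> mR} := HB.pack (E : Omega -> mR) ME.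
pose D2 : {sigma_finite_measure set mR -> \bar R} := distribution P E'.
(* Both measures factor on rectangles into the laws of [W] and [E], so each is the product of these
   laws. *)
have m1E := product_measure_unique (m1 := D1) (m2 := D2) (m' := m1).
have m2E := product_measure_unique (m1 := D1) (m2 := D2) (m' := m2).
transitivity (m1 S); first by [].
transitivity (m2 S); last by rewrite /m2/= /pushforward nuE.
rewrite -m1E// ?m2E// => A B mA mB.
  rewrite /m2/= /pushforward nuE.
  have mcA : measurable (center @^-1` A).
    by rewrite -[X in measurable X]setTI; exact: mcenter.
  transitivity (\int[(lebesgue_tuple (n:=d)) \x mu]_z
     (((fV z.1)%:E * (\1_(center @^-1` A) z.1)%:E) * ((g z.2)%:E * (\1_B z.2)%:E))).
    rewrite integral_mkcond epatch_indic; apply: eq_integral => -[v e] _.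
    rewrite /dens/= muleACA; congr (_ * _).
    rewrite -EFinM !indicE -natrM mulnb; congr (_%:R%:E); congr (_ : bool).
    by apply/idP/andP; rewrite !inE.
  pose fA (v : T) := (fV v)%:E * (\1_(center @^-1` A) v)%:E.
  pose gB (e : mR) := (g e)%:E * (\1_B e)%:E.
  rewrite (@ge0_integral_prodM _ _ _ _ _ _ _ fA gB).
  - congr (_ * _).
      rewrite [RHS](lawW mA) [RHS]integral_mkcond epatch_indic.
      exact: eq_integral.
    transitivity (exponential_prob 1 B); last by rewrite -expE.
    by rewrite /exponential_prob [RHS]integral_mkcond epatch_indic; exact: eq_integral.
  - by apply: emeasurable_funM; apply/measurable_EFinP.
  - by apply: emeasurable_funM; apply/measurable_EFinP.
  - by move=> v; rewrite mule_ge0// lee_fin.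
  - by move=> e; rewrite mule_ge0// lee_fin.
Qed.

(** The integral over [(v, e)] has one dimension more than the image point [y]. In coordinates
    [(y, s)] the exponential factor depends on [y] only, and integrating out [s] turns [fV] into
    [diag_marginal]. *)
Lemma exponential_shift_density : same_law
  (pushforward P (fun w => tshift (W w) (E w)))
  (fun A => \int[leb]_(y in A) ((g (tnth y k))%:E * diag_marginal f y)).
Proof.
move=> A mA.
pose add (z : T * mR) : T := tshift z.1 z.2.
have madd : measurable_fun setT add by apply: measurable_tshift.
pose sub (z : T * mR) : T := tshift z.1 (- z.2)%R.
have msub : measurable_fun setT sub.
  by apply: measurable_tshift => //; exact: measurableT_comp.
have mtk : measurable_fun setT (fun z : T * mR => tnth z.1 k : mR).
  exact: (measurableT_comp (measurable_tnth k) measurable_fst).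
have mS : measurable (add @^-1` A).
  by rewrite -[X in measurable X]setTI; exact: madd.
have mIA : measurable_fun setT (\1_A : T -> R) by [].
have mgz (h : T * mR -> R) : measurable_fun setT h -> measurable_fun setT (g \o h).
  by move=> mh; apply: measurableT_comp.
(* After the reflection [e = v_k - s] and the translation [v = y + s 1], the
   first coordinate of the integration point is [y] itself. *)
pose phi (z : T * mR) : \bar R :=
  (\1_A (sub z) * (fV z.1 * g (tnth z.1 k - z.2)%R))%:E.
have phi0 z : 0 <= phi z by rewrite lee_fin !mulr_ge0.
have mphi : measurable_fun setT phi.
  apply/measurable_EFinP; apply: measurable_funM.
    exact: (measurableT_comp mIA msub).
  apply: measurable_funM; first exact: (measurableT_comp mfV measurable_fst).
  by apply: (mgz (fun z => tnth z.1 k - z.2)%R); exact: measurable_funB.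
pose rho (z : T * mR) : \bar R := (\1_A z.1 * (fV (add z) * g (tnth z.1 k)))%:E.
have rho0 z : 0 <= rho z by rewrite lee_fin !mulr_ge0.
have mrho : measurable_fun setT rho.
  apply/measurable_EFinP; apply: measurable_funM.
    exact: (measurableT_comp mIA measurable_fst).
  apply: measurable_funM; first exact: (measurableT_comp mfV madd).
  exact: mgz.
pose theta (z : T * mR) : \bar R := (\1_A (add (psi z)) * (fV z.1 * g z.2))%:E.
have theta0 z : 0 <= theta z by rewrite lee_fin !mulr_ge0.
have mtheta : measurable_fun setT theta.
  apply/measurable_EFinP; apply: measurable_funM.
    exact: (measurableT_comp mIA (measurableT_comp madd mpsi)).
  apply: measurable_funM; first exact: (measurableT_comp mfV measurable_fst).
  exact: mgz.
transitivity (\int[(lebesgue_tuple (n:=d)) \x mu]_z theta z).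
  rewrite [LHS](joint_law mS) integral_mkcond epatch_indic.
  apply: eq_integral => z _.
  by rewrite /theta/= mulrC EFinM EFinM; congr (_ * _%:E); rewrite !indicE.
transitivity (\int[leb]_v \int[mu]_s phi (v, s)).
  rewrite (fubini_tonelli1 _ mtheta theta0).
  apply: eq_integral => v _; rewrite /fubini_F.
  rewrite -(ge0_integral_reflect (tnth v k) (f := fun e => theta (v, e)))//.
    apply: eq_integral => s _; rewrite /theta /phi /add /psi /sub /center/=.
    by rewrite tshiftD addKr.
  exact: measurableT_comp mtheta (pair1_measurable v).
transitivity (\int[mu]_s \int[leb]_v phi (v, s)).
  exact: (fubini_tonelli _ mphi phi0).
transitivity (\int[mu]_s \int[leb]_y rho (y, s)).
  apply: eq_integral => s _.
  rewrite -(ge0_integral_tshift s); last 2 first.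
  - exact: measurableT_comp mphi (pair2_measurable s).
  - by move=> y; exact: phi0.
  apply: eq_integral => y _; rewrite /phi /rho /sub /add/=.
  by rewrite tshiftD subrr tshift0 tnth_mktuple addrK.
transitivity (\int[leb]_y \int[mu]_s rho (y, s)).
  exact/esym/(fubini_tonelli _ mrho rho0).
rewrite [RHS]integral_mkcond; apply: eq_integral => y _; rewrite patchE.
case: ifPn => yA.
  rewrite /diag_marginal -ge0_integralZl ?lee_fin//; last 2 first.
  - by apply/measurable_EFinP; exact: measurable_shifted_prod.
  - by move=> s _; rewrite lee_fin shifted_prod_ge0.
  apply: eq_integral => s _; rewrite /rho/= indicE yA mul1r mulrC EFinM.
  by rewrite shifted_prodE.
by rewrite integral0_eq// => s _; rewrite /rho/= indicE (negbTE yA) mul0r.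
Qed.

End exponential_shift_density.

(** * Extending a density from a half-space to [calL] by homogeneity *)

Section homogeneous_density.
Local Open Scope ereal_scope.
Context {R : realType} {d : nat}.
Local Notation T := (d.-tuple R).
Local Notation leb := (lebesgue_tuple (n:=d) : set T -> \bar R).
Variables (k : 'I_d) (mu : {measure set T -> \bar R}) (lam : T -> R).
Hypothesis lam0 : forall y, (0 <= lam y)%R.
Hypothesis mlam : measurable_fun setT lam.
Hypothesis lam_shift : forall y t, lam (tshift y t) = (expR (- t) * lam y)%R.
Hypothesis mu_shift : forall (t : R) (A : set T), (0 < t)%R -> measurable A -> A `<=` calL ->
  mu [set x | A (tshift x (- t))] = (expR (- t))%:E * mu A.
Hypothesis mu_lam : forall A : set T, measurable A -> A `<=` [set y : T | (0 < tnth y k)%R] ->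
  mu A = \int[leb]_(y in A) (lam y)%:E.

(** Shifting [A] by [t] along the diagonal moves it into the half-space where the density is known.
    Both sides acquire the factor [expR (- t)], which cancels. *)
Let density_above_threshold (t : R) (A : set T) : (0 < t)%R -> measurable A -> A `<=` calL ->
  A `<=` [set y : T | (- t < tnth y k)%R] -> mu A = \int[leb]_(y in A) (lam y)%:E.
Proof.
move=> t0 mA AL At.
pose B := [set x : T | A (tshift x (- t))].
have mB : measurable B.
  rewrite -[X in measurable X]setTI.
  exact: (measurable_tshift (f := @id T) (g := cst (- t)%R)).
have Bk : B `<=` [set y : T | (0 < tnth y k)%R].
  by move=> x /At /=; rewrite tnth_mktuple ltrDr.
have := mu_lam mB Bk; rewrite mu_shift//.
have -> : \int[leb]_(y in B) (lam y)%:E =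
    (expR (- t))%:E * \int[leb]_(y in A) (lam y)%:E.
  rewrite -ge0_integralZl ?lee_fin ?expR_ge0//; last 2 first.
  - by apply/measurable_EFinP; exact: measurable_funTS.
  - by move=> y _; rewrite lee_fin.
  rewrite [LHS]integral_mkcond [RHS]integral_mkcond -[LHS](ge0_integral_tshift t); last 2 first.
  - apply/(measurable_restrictT _ _).1 => //.
    by apply/measurable_EFinP; exact: measurable_funTS.
  - by move=> y; rewrite patchE; case: ifP => //; rewrite lee_fin.
  apply: eq_integral => y _; rewrite !patchE lam_shift EFinM.
  have -> // : (tshift y t \in B) = (y \in A).
  by apply/idP/idP; rewrite !inE /B/= tshiftD subrr tshift0.
move/(congr1 (fun x => (expR t)%:E * x)).
by rewrite !muleA -!EFinM expRxMexpNx_1 !mul1e.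
Qed.

(** Continuity from below, for [mu] and for the measure with density [lam], passes from the
    thresholds to all of [A]. *)
Lemma homogeneous_density (A : set T) : measurable A -> A `<=` calL ->
  mu A = \int[leb]_(y in A) (lam y)%:E.
Proof.
move=> mA AL.
have mlamE : measurable_fun setT (EFin \o lam) by exact/measurable_EFinP.
have lamE0 y : 0 <= (EFin \o lam) y by rewrite /= lee_fin.
have [nu nuE] := ge0_density_measure (lebesgue_tuple (n:=d)) mlamE lamE0.
(* The successor makes every threshold strictly positive, as [density_above_threshold] requires. *)
pose F n := A `&` [set y : T | (- n.+1%:R < tnth y k)%R].
have mF n : measurable (F n).
  by apply: measurableI => //; exact: measurable_tnth_gt.
have ndF : nondecreasing_seq F.
  move=> m n mn; apply/subsetPset => y [Ay /= yk]; split => //=.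
  by rewrite (le_lt_trans _ yk)// lerN2 ler_nat.
have UF : \bigcup_n F n = A.
  apply/seteqP; split => [y [n _ []//]|y Ay].
  exists (Num.truncn `|tnth y k|) => //; split => //=.
  by rewrite ltrNl (le_lt_trans (ler_norm _))// normrN truncnS_gt.
have mUF : measurable (\bigcup_n F n) by rewrite UF.
have c1 := nondecreasing_cvg_mu (mu := mu) mF mUF ndF.
have c2 := nondecreasing_cvg_mu (mu := nu) mF mUF ndF.
rewrite UF in c1 c2.
have -> : \int[leb]_(y in A) (lam y)%:E = nu A by rewrite nuE.
have munu : mu \o F = nu \o F.
  apply/funext => n /=; rewrite nuE; apply: (@density_above_threshold n.+1%:R) => //.
    by move=> y [/AL].
  by move=> y [].
by rewrite munu in c1; exact: (cvg_unique (@ereal_hausdorff R) c1 c2).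
Qed.

End homogeneous_density.

(** * Densities of all conditioned vectors and their MTP2 inequality *)

Theorem proposition3p7 (R : realType) (d : nat)
    (dY : measure_display) (OmegaY : measurableType dY)
    (PY : probability OmegaY R) (Y : {RV PY >-> d.-tuple R})
    (k : 'I_d)
    (dW : measure_display) (OmegaW : measurableType dW)
    (PW : probability OmegaW R) (W : {RV PW >-> d.-tuple R})
    (dU : measure_display) (OmegaU : measurableType dU)
    (PU : probability OmegaU R) (U : 'I_d -> {RV PU >-> R}) :
  multivariate_pareto Y ->
  (exists f, is_density (@lebesgue_tuple R d) (distribution PY Y) f) ->
  extremal_function Y k W ->
  independent_family PU (fun i w => U i w) ->
  (forall i, log_concave_law PU (U i)) ->
  same_law (distribution PW W)
    (pushforward PU (fun w => [tuple U i w - U k w | i < d])) ->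
  EMTP2 Y.
Proof.
move=> paretoY _ [_ [dO [OE [P [W' [E [lawW' expE indWE lawYk]]]]]]] indU lcU lawW.
have /choice[f fP] i : exists g : R -> R,
  is_density lebesgue_measure (pushforward PU (U i)) g /\ log_concave g.
  by have [g] := lcU i; exists g.
have Uf i : is_density lebesgue_measure (pushforward PU (U i)) (f i) by case: (fP i).
have lcf i : log_concave (f i) by case: (fP i).
have mf i : measurable_fun setT (f i) by case: (Uf i).
have f0 i x : 0 <= f i x by case: (Uf i).
have intf i : (\int[lebesgue_measure]_x (f i x)%:E = 1)%E.
  have [_ _ /(_ setT measurableT) <-] := Uf i.
  by rewrite /pushforward preimage_setT probability_setT.
have d0 : (0 < d)%N by exact: leq_ltn_trans (ltn_ord k).
have mtk (m : 'I_d) : measurable [set y : d.-tuple R | 0 < tnth y m].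
  exact: measurable_tnth_gt.
have mcenter : measurable_fun setT (fun v : d.-tuple R => tshift v (- tnth v k)).
  apply: measurable_tshift => //.
  by apply: measurableT_comp => //; exact: measurable_tnth.
have lawW'U : same_law (distribution P W') (fun A => \int[lebesgue_tuple (n:=d)]_(v in
    (fun v => tshift v (- tnth v k)) @^-1` A) (\prod_(i < d) f i (tnth v i))%:E)%E.
  move=> A mA; rewrite lawW'// lawW//.
  rewrite -(independent_family_density Uf indU); last first.
    by rewrite -[X in measurable X]setTI; exact: mcenter.
  rewrite /pushforward -comp_preimage; congr (PU (_ @^-1` A)).
  by apply/funext => w; apply: eq_from_tnth => i; rewrite /= !tnth_mktuple.
have dens_k := exponential_shift_density f0 mf expE indWE lawW'U.
pose h y := fine (diag_marginal f y).
have hE y : diag_marginal f y = (h y)%:E.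
  by rewrite /h fineK//; exact: diag_marginal_fin_num.
have h0 y : 0 <= h y by rewrite fine_ge0// diag_marginal_ge0.
have mh : measurable_fun setT h.
  apply/measurable_EFinP; rewrite (_ : _ \o _ = diag_marginal f).
    exact: measurable_diag_marginal.
  by apply/funext => y; rewrite /= hE.
pose mass m := fine (PY (Y @^-1` [set y : d.-tuple R | 0 < tnth y m])).
have mass0 m : 0 <= mass m by rewrite fine_ge0.
(* The factor [mass k] undoes the conditioning on a positive [k]-th coordinate, so [lam] is the
   candidate density of [Y] on all of [calL]. *)
pose lam y := mass k * (expR (- tnth y k) * h y).
have lam0 y : 0 <= lam y by rewrite !mulr_ge0 ?expR_ge0.
have mlam : measurable_fun setT lam.
  apply: measurable_funM => //; apply: measurable_funM => //.
  apply: measurableT_comp => //; apply: measurableT_comp => //.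
  exact: measurable_tnth.
have lam_shift y t : lam (tshift y t) = expR (- t) * lam y.
  rewrite /lam /h diag_marginal_tshift// tnth_mktuple opprD expRD; ring.
have cond_probE m A : cond_pos_law Y m A =
    (fine (distribution PY Y (A `&` [set y : d.-tuple R | 0 < tnth y m])) / mass m)%:E by [].
(* If [mass k] were 0, division by zero would make [cond_pos_law Y k] identically 0, whereas [lawYk]
   gives it total mass 1. *)
have mass_k : mass k != 0.
  apply/eqP => mass_k0.
  have := lawYk setT measurableT; rewrite cond_probE mass_k0 invr0 mulr0.
  rewrite /pushforward preimage_setT probability_setT => /eqP.
  by rewrite eqe eq_sym oner_eq0.
have lam_k A : measurable A -> A `<=` [set y : d.-tuple R | 0 < tnth y k] ->
    (distribution PY Y A = \int[lebesgue_tuple (n:=d)]_(y in A) (lam y)%:E)%E.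
  move=> mA Ak.
  have := lawYk A mA; rewrite dens_k// cond_probE setIidl// => DE.
  have -> : distribution PY Y A = ((mass k)%:E * (fine (distribution PY Y A) / mass k)%:E)%E.
    by rewrite -EFinM mulrC divfK// fineK// fin_num_measure.
  rewrite DE -ge0_integralZl ?lee_fin//; last 2 first.
  - apply: measurable_funTS; apply: emeasurable_funM.
      apply/measurable_EFinP; apply: measurableT_comp.
        exact: measurable_exponential_pdf.
      exact: measurable_tnth.
    exact: measurable_diag_marginal.
  - move=> y _; rewrite mule_ge0 ?diag_marginal_ge0//.
    by rewrite lee_fin exponential_pdf_ge0.
  apply: eq_integral => y /[!inE] /Ak/= yk.
  rewrite hE -!EFinM /lam exponential_pdfE ?ltW//.
  by rewrite mul1r mulN1r.
have law_lam A : measurable A -> A `<=` calL ->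
    (distribution PY Y A = \int[lebesgue_tuple (n:=d)]_(y in A) (lam y)%:E)%E.
  apply: (homogeneous_density (k := k) (mu := distribution PY Y)) => // t B t0 mB BL.
  exact: multivariate_pareto_homogeneous.
move=> m.
(* The exponential factor in [lam] still involves coordinate [k]; [m] enters only through the
   indicator and the normalization. The convention that the inverse of 0 is 0 matches the one in
   [cond_pos_law]. *)
pose gm y := (mass m)^-1 * (lam y * (0 < tnth y m)%R%:R).
have gm0 y : 0 <= gm y by rewrite !mulr_ge0 ?invr_ge0.
have mgm : measurable_fun setT gm.
  apply: measurable_funM => //; apply: measurable_funM => //.
  rewrite (_ : (fun y => _) = \1_[set y : d.-tuple R | 0 < tnth y m]).
    exact/measurable_indicP.
  apply/funext => y; rewrite indicE; congr (_%:R); congr (_ : bool).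
  by apply/idP/idP; rewrite inE.
exists gm.
  split => //.
  move=> A mA; rewrite cond_probE.
  have mAm : measurable (A `&` [set y : d.-tuple R | 0 < tnth y m]).
    exact: measurableI.
  rewrite mulrC EFinM fineK; last by rewrite fin_num_measure.
  rewrite law_lam//; last by move=> y [_ ym]; exists m.
  rewrite -ge0_integralZl ?lee_fin ?invr_ge0//; last 2 first.
  - by apply/measurable_EFinP; exact: measurable_funTS.
  - by move=> y _; rewrite lee_fin.
  rewrite [LHS]integral_mkcondr; apply: eq_integral => y _.
  rewrite patchE /gm; have [ym|ym] := boolP (0 < tnth y m).
    by rewrite mem_set// mulr1 EFinM.
  by rewrite memNset ?mulr0//; exact/negP.
move=> x y; rewrite /gm.
(* If an indicator on the left vanishes, so does the left side. Otherwise the maximum and minimum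
   also have positive [m]-th coordinates and all four indicators equal 1. *)
have [xm|xm] := ltP 0 (tnth x m); last first.
  by rewrite mulr0 mulr0 mul0r; exact: mulr_ge0 (gm0 _) (gm0 _).
have [ym|ym] := ltP 0 (tnth y m); last by rewrite !mulr0; exact: mulr_ge0 (gm0 _) (gm0 _).
rewrite !tnth_mktuple lt_max xm lt_min xm ym/= !mulr1.
have hxy : h x * h y <= h (tmax x y) * h (tmin x y).
  by rewrite -lee_fin !EFinM -!hE; exact: diag_marginal_MTP2.
rewrite mulrACA [leRHS]mulrACA ler_wpM2l ?mulr_ge0 ?invr_ge0// /lam.
rewrite mulrACA [leRHS]mulrACA ler_wpM2l ?mulr_ge0//.
rewrite mulrACA [leRHS]mulrACA -!expRD !tnth_mktuple.
(* Maximum and minimum have the same sum as the two numbers, so the exponential factors on both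
   sides agree and only the inequality for [h] remains. *)
have -> : - Num.max (tnth x k) (tnth y k) + - Num.min (tnth x k) (tnth y k) =
   - tnth x k + - tnth y k by case: leP => _; lra.
by rewrite ler_wpM2l ?expR_ge0.
Qed.
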